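(* Let $n\ge 2$, let $i\in\{1,\dots,n-1\}$ and let $\alpha>1/2$. Then there is no function $C:(0,\infty)\to(0,\infty)$ such that $$ d_{bL}(\Lambda_i(K,\cdot),\Lambda_i(L,\cdot))\le C(R)\, d_H(K,L)^{\alpha} $$ holds for all $R>0$ and all convex bodies $K,L\subset\mathbb{R}^n$ for which $K_2=K+2B^n$ and $L_2=L+2B^n$ are both contained in some ball of radius $R$. Here $\Lambda_i(K,\cdot)$ denotes the $i$th support measure of $K$, $d_{bL}$ the bounded Lipschitz metric and $d_H$ the Hausdorff metric.
   Context: A convex body in $\mathbb{R}^n$ is a nonempty compact convex subset; $B^n$ is the closed unit ball and $|\cdot|$ the Euclidean norm. For $\rho\ge 0$, $K_\rho:=K+\rho B^n$ is the parallel body of $K$. The Hausdorff distance is $d_H(K,L)=\min\{\rho\ge0: K\subset L_\rho,\ L\subset K_\rho\}$. For a convex body $K$ and $x\in\mathbb{R}^n$, $p_K(x)$ is the unique point of $K$ nearest to $x$, $d_K(x)=|x-p_K(x)|$, and for $x\notin K$, $u_K(x)=(x-p_K(x))/d_K(x)\in\mathbb{S}^{n-1}$. For $\rho>0$, $K^\rho:=K_\rho\setminus K$. Let $\Sigma^n:=\mathbb{R}^n\times\mathbb{S}^{n-1}$ with the Euclidean metric induced from $\mathbb{R}^n\times\mathbb{R}^n$. For Borel $\eta\subset\Sigma^n$ put $$\mu_{K,\rho}(\eta):=\mathcal{H}^n(\{x\in K^\rho:(p_K(x),u_K(x))\in\eta\}),$$ where $\mathcal{H}^n$ is $n$-dimensional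 Hausdorff measure. The support measures $\Lambda_0(K,\cdot),\dots,\Lambda_{n-1}(K,\cdot)$ are the finite Borel measures on $\Sigma^n$ uniquely determined by $$\mu_{K,\rho}(\eta)=\sum_{i=0}^{n-1}\rho^{n-i}\kappa_{n-i}\Lambda_i(K,\eta)\quad\text{for all }\rho>0\text{ and all Borel }\eta\subset\Sigma^n,$$ where $\kappa_j$ is the $j$-dimensional volume of $B^j$ (the existence of this expansion, the local Steiner formula, is a known fact). For finite Borel measures $\mu,\nu$ on $\Sigma^n$, $$d_{bL}(\mu,\nu):=\sup\left\{\left|\int f\,d\mu-\int f\,d\nu\right|: f:\Sigma^n\to\mathbb{R},\ \|f\|_L\le1,\ \|f\|_\infty\le1\right\},$$ where $\|f\|_L=\sup_{a\ne b}|f(a)-f(b)|/|a-b|$ and $\|f\|_\infty=\sup_a|f(a)|$. *)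

(* Defs.v *)
From HB Require Import structures.
From mathcomp Require Import all_boot all_order all_algebra.
From mathcomp Require Import all_classical all_reals all_analysis.

Set Implicit Arguments.
Unset Strict Implicit.
Unset Printing Implicit Defensive.

Import Order.TTheory GRing.Theory Num.Theory.
Import numFieldNormedType.Exports.

Local Open Scope classical_set_scope.
Local Open Scope ring_scope.

(* The norm `|x| that the library puts on 'rV[R]_n is the sup norm; it induces
   the same topology as [enorm]. *)
Definition enorm (R : realType) (n : nat) (x : 'rV[R]_n) : R :=
  Num.sqrt (\sum_i x 0 i ^+ 2).

Definition eball (R : realType) (n : nat) (z : 'rV[R]_n) (r : R) :
  set 'rV[R]_n := [set x | enorm (x - z) <= r].

Definition convex_body (R : realType) (n : nat) (K : set 'rV[R]_n) : Prop :=
  [/\ K !=set0, compact K & convex_set (K : set (convex_lmodType 'rV[R]_n))].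

Definition parallel_body (R : realType) (n : nat) (K : set 'rV[R]_n) (rho : R) :
  set 'rV[R]_n := [set x + rho *: b | x in K & b in eball 0 1].

(* An infimum that is attained when K and L are convex bodies. *)
Definition hausdorff_dist (R : realType) (n : nat) (K L : set 'rV[R]_n) : R :=
  inf [set rho | [/\ 0 <= rho, K `<=` parallel_body L rho
                   & L `<=` parallel_body K rho]].

Definition metric_proj (R : realType) (n : nat) (K : set 'rV[R]_n)
    (x : 'rV[R]_n) : 'rV[R]_n :=
  xget 0 [set p | K p /\ forall y, K y -> enorm (x - p) <= enorm (x - y)].

Definition dist_to (R : realType) (n : nat) (K : set 'rV[R]_n)
    (x : 'rV[R]_n) : R := enorm (x - metric_proj K x).

Definition unit_normal (R : realType) (n : nat) (K : set 'rV[R]_n)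
    (x : 'rV[R]_n) : 'rV[R]_n := (dist_to K x)^-1 *: (x - metric_proj K x).

(* pi^(s/2) / Gamma(s/2 + 1), by the recursion Gamma(z + 1) = z Gamma(z): the
   constant for which s-dimensional Hausdorff measure on R^s is Lebesgue
   measure. *)
Fixpoint hausdorff_cst (R : realType) (s : nat) : R :=
  match s with
  | 0 => 1
  | 1 => 2
  | s'.+2 => 2 * pi / s'.+2%:R * hausdorff_cst R s'
  end.

(* -oo for the empty set *)
Definition ediam (R : realType) (n : nat) (A : set 'rV[R]_n) : \bar R :=
  ereal_sup [set (enorm (x - y))%:E | x in A & y in A].

(* Only meaningful for A of finite diameter. *)
Definition hausdorff_gauge (R : realType) (n s : nat) (A : set 'rV[R]_n) :
    \bar R :=
  if A == set0 then 0%E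
  else (hausdorff_cst R s * (fine (ediam A) / 2) ^+ s)%:E.

Definition hausdorff_content (R : realType) (n s : nat) (delta : R)
    (A : set 'rV[R]_n) : \bar R :=
  ereal_inf [set (\sum_(0 <= k <oo) hausdorff_gauge s (U k))%E
            | U in [set U : nat -> set 'rV[R]_n |
                     A `<=` \bigcup_k U k /\
                     forall k, (ediam (U k) <= delta%:E)%E]].

Definition hausdorff_measure (R : realType) (n s : nat) (A : set 'rV[R]_n) :
    \bar R :=
  ereal_sup [set hausdorff_content s delta A | delta in [set d : R | 0 < d]].

Definition kappa (R : realType) (j : nat) : \bar R :=
  hausdorff_measure j (eball (0 : 'rV[R]_j) 1).

Definition Sigma_set (R : realType) (n : nat) : set ('rV[R]_n * 'rV[R]_n) :=
  [set a | enorm a.2 = 1].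
Arguments Sigma_set : clear implicits.

(* Carries the topology induced from the product R^n * R^n, which is that of
   [Sigma_dist]. *)
Definition Sigma (R : realType) (n : nat) : Type := set_type (Sigma_set R n).

HB.instance Definition _ (R : realType) (n : nat) :=
  Topological.copy (Sigma R n) (set_type (Sigma_set R n)).

Lemma enorm_delta (R : realType) (n : nat) :
  enorm (delta_mx 0 0 : 'rV[R]_n.+1) = 1.
Proof.
rewrite /enorm (bigD1 ord0) //= big1 ?addr0 => [|i i0].
  by rewrite mxE !eqxx expr1n sqrtr1.
by rewrite mxE (negPf i0) andbF expr0n.
Qed.

Lemma Sigma_point_subproof (R : realType) (n : nat) :
  ((0, delta_mx 0 0) : 'rV[R]_n.+1 * 'rV[R]_n.+1) \in Sigma_set R n.+1.
Proof. by rewrite inE; exact: enorm_delta. Qed.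

(* Measurable types are pointed, and Sigma R 0 is empty: hence the dimension
   n.+1 in what follows. *)
HB.instance Definition _ (R : realType) (n : nat) :=
  isPointed.Build (Sigma R n.+1)
    (SigSub (Sigma_point_subproof R n)).

Definition Sigma_dist (R : realType) (n : nat) (a b : Sigma R n) : R :=
  Num.sqrt (enorm ((val a).1 - (val b).1) ^+ 2 +
            enorm ((val a).2 - (val b).2) ^+ 2).

Notation borel_Sigma R n := (g_sigma_algebraType (@open (Sigma R n))).

Definition local_parallel_volume (R : realType) (n : nat) (K : set 'rV[R]_n)
    (rho : R) (eta : set (Sigma R n)) : \bar R :=
  hausdorff_measure n
    [set x | (parallel_body K rho `\` K) x /\
             (val @` eta) (metric_proj K x, unit_normal K x)].

(* The local Steiner formula, which determines the family Lam. *)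
Definition support_measures (R : realType) (n : nat) (K : set 'rV[R]_n.+1)
    (Lam : 'I_n.+1 -> {finite_measure set (borel_Sigma R n.+1) -> \bar R}) :
    Prop :=
  forall rho : R, 0 < rho ->
  forall eta : set (borel_Sigma R n.+1), measurable eta ->
    local_parallel_volume K rho eta =
    (\sum_(i < n.+1) (rho ^+ (n.+1 - i))%:E * kappa R (n.+1 - i) * Lam i eta)%E.

Definition lip_norm (R : realType) (n : nat) (f : Sigma R n -> R) : \bar R :=
  ereal_sup [set (`|f ab.1 - f ab.2| / Sigma_dist ab.1 ab.2)%:E
            | ab in [set ab : Sigma R n * Sigma R n | ab.1 <> ab.2]].

Definition sup_norm (R : realType) (n : nat) (f : Sigma R n -> R) : \bar R :=
  ereal_sup [set `|f a|%:E | a in [set: Sigma R n]].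

(* Extended-real valued, but finite: the supremum is at most the sum of the
   total masses. *)
Definition dbL (R : realType) (n : nat)
    (mu nu : {finite_measure set (borel_Sigma R n.+1) -> \bar R}) : \bar R :=
  ereal_sup [set `|\int[mu]_a f a - \int[nu]_a f a|%:E
            | f in [set f : Sigma R n.+1 -> R |
                     (lip_norm f <= 1)%E /\ (sup_norm f <= 1)%E]].

(* Main.v *)
(* Let K_N be the set of x with 0 <= x_j <= 1 for j <= i and x_j = 0 for j > i
   that lie above the tangents of the parabola x_i = x_0^2 at the points
   x_0 = k / N, k <= N.  Then K_2N is contained in K_N, and their Hausdorff
   distance is at most 1 / (4 N^2).  The function
     f(u) = min (|u_i|, min_k |u_0 + (2 k / N) u_i|) / 3
   of the normal is 1-Lipschitz and vanishes on the normals at the i-faces of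
   K_N, hence almost everywhere for Lambda_i(K_N); but it is at least of order
   1 / N on the normals along the N edges of K_2N at odd tangents, which carry a
   Lambda_i(K_2N)-mass bounded below.  So d_bL is at least c / N while d_H^alpha
   is of order N^(-2 alpha), which is o(1 / N).

   To have this one needs the support measures of polyhedra.  They are
     Lambda_i(eta) = kappa_{m-i}^-1 H^m {x in K_1 \ K : codim p_K(x) = m - i,
                                          (p_K(x), u_K(x)) in eta},
   m being the dimension of the space and codim p the rank of the constraints
   active at p: where the set of active constraints of p_K(x) is constant, the
   stretching p_K(x) + rho (x - p_K(x)) is the restriction of a linear map up to
   translation, which multiplies H^m by rho^(m - i).  That H^m scales by a
   factor under linear maps follows from the uniqueness, up to a factor, of
   translation-invariant Borel measures. *)

Require Import Defs.
From HB Require Import structures.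
From mathcomp Require Import all_boot all_order all_algebra.
From mathcomp Require Import all_classical all_reals all_analysis.
From mathcomp Require Import measurable_realfun.
From mathcomp Require Import ring lra zify.

Set Implicit Arguments.
Unset Strict Implicit.
Unset Printing Implicit Defensive.

Import Order.TTheory GRing.Theory Num.Theory.
Import numFieldNormedType.Exports.

Local Open Scope classical_set_scope.
Local Open Scope ring_scope.

(** * Hausdorff measure on Borel sets *)

(** The exponent 1/2 comes from a mismatch of orders. Tangents of the parabola at two points 1 / N
    apart meet 1 / (4 N^2) below it, so adding the tangent at the midpoint moves the body by a
    quadratic amount, whereas the new slope differs from the old ones by the linear amount 1 / N.
    The new edges together lie over half of the interval [0, 1] of x_0, hence their mass does not
    decay. The coordinates strictly between x_0 and x_i are free and raise the dimension of the
    faces to i.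

    The bound to be refuted is claimed for all families satisfying the Steiner formula, so one
    explicit family for each polyhedron suffices. What the argument takes from H^m is additivity on
    Borel sets, translation invariance, and that the unit cube has positive finite measure.
    Finiteness follows by subdivision; positivity is the harder half and is obtained by comparing
    covers with boxes, through Lebesgue measure on the line. *)

Section Euclidean.
Context (R : realType) (n : nat).
Implicit Types (x y z : 'rV[R]_n) (c : R).

Definition dot x y : R := \sum_i x 0 i * y 0 i.

Lemma dotC x y : dot x y = dot y x.
Proof. by apply: eq_bigr => i _; rewrite mulrC. Qed.

Lemma dotDl x y z : dot (x + y) z = dot x z + dot y z.
Proof. by rewrite -big_split; apply: eq_bigr => i _; rewrite mxE mulrDl. Qed.

Lemma dotZl c x y : dot (c *: x) y = c * dot x y.
Proof. by rewrite mulr_sumr; apply: eq_bigr => i _; rewrite mxE mulrA. Qed.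

Lemma dotNl x y : dot (- x) y = - dot x y.
Proof. by rewrite -scaleN1r dotZl mulN1r. Qed.

Lemma dotBl x y z : dot (x - y) z = dot x z - dot y z.
Proof. by rewrite dotDl dotNl. Qed.

Lemma dotDr x y z : dot x (y + z) = dot x y + dot x z.
Proof. by rewrite dotC dotDl !(dotC x). Qed.

Lemma dotZr c x y : dot x (c *: y) = c * dot x y.
Proof. by rewrite dotC dotZl dotC. Qed.

Lemma dotNr x y : dot x (- y) = - dot x y.
Proof. by rewrite dotC dotNl dotC. Qed.

Lemma dotBr x y z : dot x (y - z) = dot x y - dot x z.
Proof. by rewrite dotDr dotNr. Qed.

Lemma dot0l x : dot 0 x = 0.
Proof. by rewrite -(scale0r 0) dotZl mul0r. Qed.

Lemma dot_ge0 x : 0 <= dot x x.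
Proof. by apply: sumr_ge0 => i _; rewrite -expr2 sqr_ge0. Qed.

Lemma dotE x y : dot x y = (x *m y^T) 0 0.
Proof. by rewrite mxE; apply: eq_bigr => i _; rewrite mxE. Qed.

Lemma enorm_ge0 x : 0 <= enorm x.
Proof. exact: sqrtr_ge0. Qed.

Lemma enorm_sqr x : enorm x ^+ 2 = dot x x.
Proof.
rewrite sqr_sqrtr; first by apply: eq_bigr => i _; rewrite expr2.
by apply: sumr_ge0 => i _; rewrite sqr_ge0.
Qed.

Lemma le_coord_enorm x i : `|x 0 i| <= enorm x.
Proof.
rewrite -(@ler_pXn2r _ 2%N) ?nnegrE ?enorm_ge0// enorm_sqr real_normK ?num_real//.
rewrite /dot (bigD1 i)//= -expr2 lerDl; apply: sumr_ge0 => j _.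
by rewrite -expr2 sqr_ge0.
Qed.

Lemma enorm_eq0 x : (enorm x == 0) = (x == 0).
Proof.
apply/eqP/eqP => [x0|->]; last first.
  by rewrite /enorm big1 ?sqrtr0// => i _; rewrite mxE expr0n.
by apply/rowP => i; have := le_coord_enorm x i; rewrite x0 normr_le0 mxE => /eqP.
Qed.

Lemma enorm0 : enorm (0 : 'rV[R]_n) = 0.
Proof. by apply/eqP; rewrite enorm_eq0. Qed.

Lemma dot_eq0 x : (dot x x == 0) = (x == 0).
Proof. by rewrite -enorm_sqr sqrf_eq0 enorm_eq0. Qed.

Lemma enormZ c x : enorm (c *: x) = `|c| * enorm x.
Proof.
apply/eqP; rewrite -(@eqrXn2 _ 2%N) ?enorm_ge0 ?mulr_ge0 ?enorm_ge0//.
by rewrite exprMn !enorm_sqr dotZl dotZr mulrA -expr2 real_normK ?num_real.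
Qed.

Lemma enormN x : enorm (- x) = enorm x.
Proof. by rewrite -scaleN1r enormZ normrN1 mul1r. Qed.

Lemma enorm_distC x y : enorm (x - y) = enorm (y - x).
Proof. by rewrite -enormN opprB. Qed.

Lemma dot_le_enorm x y : dot x y <= enorm x * enorm y.
Proof.
have [->|y0] := eqVneq y 0; first by rewrite enorm0 mulr0 dotC dot0l.
have yy : 0 < dot y y by rewrite lt_def dot_eq0 y0 dot_ge0.
apply: (le_trans (ler_norm _)).
rewrite -(@ler_pXn2r _ 2%N) ?nnegrE ?mulr_ge0 ?enorm_ge0//.
rewrite real_normK ?num_real// exprMn !enorm_sqr.
(* This vector is |y|^2 times the component of [x] orthogonal to [y]. *)
have := dot_ge0 (dot y y *: x - dot x y *: y).
rewrite !dotBl !dotBr !dotZl !dotZr (dotC y x) => h.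
have : 0 <= dot y y * (dot x x * dot y y - dot x y ^+ 2).
  by apply: le_trans h _; rewrite le_eqVlt; apply/orP; left; apply/eqP; ring.
by rewrite pmulr_rge0// subr_ge0.
Qed.

Lemma enormD x y : enorm (x + y) <= enorm x + enorm y.
Proof.
rewrite -(@ler_pXn2r _ 2%N) ?nnegrE ?addr_ge0 ?enorm_ge0//.
rewrite sqrrD !enorm_sqr dotDl !dotDr (dotC y x).
have := dot_le_enorm x y; lra.
Qed.

Lemma enorm_triangle z x y : enorm (x - y) <= enorm (x - z) + enorm (z - y).
Proof. by rewrite -[x - y](subrKA z) enormD. Qed.

Lemma norm_le_enorm x : `|x| <= enorm x.
Proof.
rewrite [leLHS]/Num.norm/= mx_normrE; apply/bigmax_leP; split; first exact: enorm_ge0.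
by move=> [i j] _ /=; rewrite ord1 le_coord_enorm.
Qed.

Lemma enorm_le_coord x c : 0 <= c -> (forall i, `|x 0 i| <= c) ->
  enorm x <= n%:R * c.
Proof.
move=> c0 xc; rewrite -(@ler_pXn2r _ 2%N) ?nnegrE ?mulr_ge0 ?enorm_ge0//.
rewrite enorm_sqr /dot exprMn.
apply: (@le_trans _ _ (\sum_(i < n) c ^+ 2)).
  apply: ler_sum => i _; rewrite -expr2 -(real_normK (num_real (x 0 i))).
  by rewrite ler_pXn2r ?nnegrE.
rewrite sumr_const card_ord -[leLHS]mulr_natl ler_wpM2r ?sqr_ge0//.
rewrite -natrX ler_nat; case: (n) => // k; exact: leq_pmulr.
Qed.

Lemma enorm_le_norm x : enorm x <= n%:R * `|x|.
Proof.
apply: enorm_le_coord => // i.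
rewrite [leRHS]/Num.norm/= mx_normrE.
exact: (le_bigmax 0 (fun ij : 'I_1 * 'I_n => `|x ij.1 ij.2|) (0, i)).
Qed.

End Euclidean.

Section HausdorffMeasure.
Context (R : realType) (n : nat).
Implicit Types (A B U : set 'rV[R]_n) (s : nat) (d : R).
Local Open Scope ereal_scope.

Lemma hausdorff_cst_gt0 s : (0 < hausdorff_cst R s)%R.
Proof.
suff : (0 < hausdorff_cst R s)%R /\ (0 < hausdorff_cst R s.+1)%R by case.
elim: s => [//|s [s0 s1]]; split => //=.
by rewrite mulr_gt0// divr_gt0// mulr_gt0// pi_gt0.
Qed.

Lemma le_ediam A x y : A x -> A y -> (enorm (x - y))%:E <= ediam A.
Proof. by move=> Ax Ay; apply: ereal_sup_ubound; exists x => //; exists y. Qed.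

Lemma ediam_le A (b : \bar R) :
  (forall x y, A x -> A y -> (enorm (x - y))%:E <= b) -> ediam A <= b.
Proof. by move=> h; apply: ge_ereal_sup => _ [x Ax [y Ay] <-]; exact: h. Qed.

Lemma ediam_ge0 A : A !=set0 -> 0 <= ediam A.
Proof. by move=> [x Ax]; have := le_ediam Ax Ax; rewrite subrr enorm0. Qed.

Lemma hausdorff_gauge0 s : hausdorff_gauge s (set0 : set 'rV[R]_n) = 0.
Proof. by rewrite /hausdorff_gauge eqxx. Qed.

Lemma hausdorff_gauge_ge0 s A : 0 <= hausdorff_gauge s A.
Proof.
rewrite /hausdorff_gauge; case: ifPn => // /set0P A0; rewrite lee_fin.
apply: mulr_ge0; first exact/ltW/hausdorff_cst_gt0.
by rewrite exprn_ge0// divr_ge0// fine_ge0// ediam_ge0.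
Qed.

(** Since [fine] sends +oo to 0, the gauge is monotone only among sets of finite diameter; the bound
    by [d] ensures this. *)
Lemma hausdorff_gauge_le s d A U :
  (A !=set0 -> U !=set0 /\ ediam A <= ediam U) -> ediam U <= d%:E ->
  hausdorff_gauge s A <= hausdorff_gauge s U.
Proof.
have [->|/set0P A0] := eqVneq A set0.
  by rewrite hausdorff_gauge0 hausdorff_gauge_ge0.
move=> /(_ A0)[U0 AU Ud]; rewrite /hausdorff_gauge.
move/set0P : (A0) => /negbTE ->; move/set0P : (U0) => /negbTE ->; rewrite lee_fin.
have A00 := ediam_ge0 A0; have U00 := ediam_ge0 U0.
have fU : ediam U \is a fin_num by rewrite ge0_fin_numE// (le_lt_trans Ud)// ltry.
have fA : ediam A \is a fin_num.
  by rewrite ge0_fin_numE// (le_lt_trans AU)// (le_lt_trans Ud)// ltry.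
apply: ler_wpM2l; first exact/ltW/hausdorff_cst_gt0.
apply: lerXn2r; rewrite ?nnegrE ?divr_ge0 ?fine_ge0//.
by rewrite ler_wpM2r// fine_le.
Qed.

Lemma ediamS A B : A `<=` B -> ediam A <= ediam B.
Proof. by move=> AB; apply: ediam_le => x y /AB Bx /AB By; exact: le_ediam. Qed.

(** The weight +oo on sets of large diameter moves the restriction on covers into the gauge, which
    gives the content the form of [mu_ext]. *)
Let delta_gauge s d U : \bar R :=
  if ediam U <= d%:E then hausdorff_gauge s U else +oo.

Let delta_gauge0 s d : delta_gauge s d set0 = 0.
Proof.
by rewrite /delta_gauge/= ediam_le ?hausdorff_gauge0// => x y [].
Qed.

Let delta_gauge_ge0 s d U : 0 <= delta_gauge s d U.
Proof. by rewrite /delta_gauge; case: ifP => // _; exact: hausdorff_gauge_ge0. Qed.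

Let discrete := g_sigma_algebraType [set: set 'rV[R]_n].

(* Every set is measurable for the discrete sigma-algebra, so that the
   covering construction [mu_ext] ranges over all covers. *)
Let hausdorff_contentE s d :
  hausdorff_content s d = mu_ext (delta_gauge s d : set discrete -> \bar R).
Proof.
apply/funext => A; apply/eqP; rewrite eq_le; apply/andP; split.
  apply: le_ereal_inf_tmp => _ [F [mF AF] <-].
  have [Fd|] := pselect (forall k, ediam (F k) <= d%:E); last first.
    move=> /existsNP[k /negP Fk]; rewrite (eseries_pinfty _ (erefl : xpredT k)) ?leey//.
    - by move=> ? _; rewrite gt_eqF// (lt_le_trans ltNy0).
    - by rewrite /delta_gauge (negbTE Fk).
  apply: ereal_inf_lbound; exists F => //.
  by apply: eq_eseriesr => k _; rewrite /delta_gauge Fd.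
apply: le_ereal_inf_tmp => _ [U [AU Ud] <-].
apply: ereal_inf_lbound; exists U.
  by split=> // k; exact: sub_sigma_algebra.
by apply: eq_eseriesr => k _; rewrite /delta_gauge Ud.
Qed.

Lemma hausdorff_content0 s d : hausdorff_content s d (set0 : set 'rV[R]_n) = 0.
Proof. by rewrite hausdorff_contentE mu_ext0. Qed.

Lemma hausdorff_content_ge0 s d A : 0 <= hausdorff_content s d A.
Proof. by rewrite hausdorff_contentE mu_ext_ge0. Qed.

Lemma le_hausdorff_content s d :
  {homo (@hausdorff_content R n s d) : A B / A `<=` B >-> A <= B}.
Proof. by move=> A B AB; rewrite hausdorff_contentE le_mu_ext. Qed.

Lemma hausdorff_content_sigma_subadditive s d :
  sigma_subadditive (hausdorff_content s d : set 'rV[R]_n -> \bar R).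
Proof.
move=> F; rewrite hausdorff_contentE.
exact: (@mu_ext_sigma_subadditive _ discrete).
Qed.

Lemma hausdorff_content_antimono s d d' A : (d <= d')%R ->
  hausdorff_content s d' A <= hausdorff_content s d A.
Proof.
move=> dd'; apply: le_ereal_inf_tmp => _ [U [AU Ud] <-].
apply: ereal_inf_lbound; exists U => //; split => // k.
by rewrite (le_trans (Ud k))// lee_fin.
Qed.

Lemma le_hausdorff_measure_content s d A : (0 < d)%R ->
  hausdorff_content s d A <= hausdorff_measure s A.
Proof. by move=> d0; apply: ereal_sup_ubound; exists d. Qed.

Lemma hausdorff_measure0 s : hausdorff_measure s (set0 : set 'rV[R]_n) = 0.
Proof.
apply/eqP; rewrite eq_le; apply/andP; split.
  by apply: ge_ereal_sup => _ [d d0 <-]; rewrite hausdorff_content0.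
by rewrite -(hausdorff_content0 s 1); exact: le_hausdorff_measure_content.
Qed.

Lemma hausdorff_measure_ge0 s A : 0 <= hausdorff_measure s A.
Proof.
apply: le_trans (hausdorff_content_ge0 s 1 A) _.
exact: le_hausdorff_measure_content.
Qed.

Lemma le_hausdorff_measure s :
  {homo (@hausdorff_measure R n s) : A B / A `<=` B >-> A <= B}.
Proof.
move=> A B AB; apply: ge_ereal_sup => _ [d d0 <-].
apply: le_trans (le_hausdorff_content s d AB) _.
exact: le_hausdorff_measure_content.
Qed.

Lemma hausdorff_measure_sigma_subadditive s :
  sigma_subadditive (hausdorff_measure s : set 'rV[R]_n -> \bar R).
Proof.
move=> F; apply: ge_ereal_sup => _ [d d0 <-].
apply: le_trans (hausdorff_content_sigma_subadditive s d F) _.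
apply: lee_nneseries => [k _ _|k _]; first exact: hausdorff_content_ge0.
exact: le_hausdorff_measure_content.
Qed.

HB.instance Definition _ s d := isOuterMeasure.Build R 'rV[R]_n
  (hausdorff_content s d) (hausdorff_content0 s d) (hausdorff_content_ge0 s d)
  (le_hausdorff_content s d) (hausdorff_content_sigma_subadditive s d).

HB.instance Definition _ s := isOuterMeasure.Build R 'rV[R]_n
  (hausdorff_measure s) (hausdorff_measure0 s) (hausdorff_measure_ge0 s)
  (le_hausdorff_measure s) (hausdorff_measure_sigma_subadditive s).

(** A set of diameter at most [d] cannot meet both [A] and [B]. Hence a cover of the union splits
    into the members that meet [A] and the others, which cover [B]. *)
Lemma hausdorff_content_separated s d A B : (0 < d)%R ->
  (forall x y, A x -> B y -> d%:E < (enorm (x - y))%:E) ->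
  hausdorff_content s d A + hausdorff_content s d B <=
  hausdorff_content s d (A `|` B).
Proof.
move=> d0 AB; apply: le_ereal_inf_tmp => _ [U [ABU Ud] <-].
pose V k := if pselect (U k `&` A !=set0) then U k else set0.
pose W k := if pselect (U k `&` A !=set0) then set0 else U k.
have dV k : ediam (V k) <= d%:E.
  by apply: le_trans (Ud k); apply: ediamS; rewrite /V; case: pselect => ? //= x [].
have dW k : ediam (W k) <= d%:E.
  by apply: le_trans (Ud k); apply: ediamS; rewrite /W; case: pselect => ? //= x [].
have -> : \sum_(0 <= k <oo) hausdorff_gauge s (U k) =
    \sum_(0 <= k <oo) hausdorff_gauge s (V k) +
    \sum_(0 <= k <oo) hausdorff_gauge s (W k).
  rewrite -nneseriesD; last 2 first.
  - by move=> k _ _; exact: hausdorff_gauge_ge0.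
  - by move=> k _ _; exact: hausdorff_gauge_ge0.
  apply: eq_eseriesr => k _; rewrite /V /W; case: pselect => _ /=;
    by rewrite hausdorff_gauge0 ?adde0 ?add0e.
apply: leeD; apply: ereal_inf_lbound.
  exists V => //; split => // x Ax.
  have [k _ Ukx] := ABU _ (or_introl Ax); exists k => //.
  by rewrite /V; case: pselect => // -[]; exists x.
exists W => //; split => // y By.
have [k _ Uky] := ABU _ (or_intror By); exists k => //.
rewrite /W; case: pselect => // -[x [Ux Ax]].
by have := lt_le_trans (AB _ _ Ax By) (le_trans (le_ediam Ux Uky) (Ud k)); rewrite ltxx.
Qed.

(** This makes [hausdorff_measure] a metric outer measure. The suprema for [A] and for [B] are
    isolated one after the other, which takes finiteness for the subtractions; the two mesh sizes
    are then lowered to their minimum, which can only increase the contents. *)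
Lemma hausdorff_measure_separated s d A B : (0 < d)%R ->
  (forall x y, A x -> B y -> (d < enorm (x - y))%R) ->
  hausdorff_measure s A + hausdorff_measure s B <= hausdorff_measure s (A `|` B).
Proof.
move=> d0 AB.
have [->|] := eqVneq (hausdorff_measure s (A `|` B)) +oo; first by rewrite leey.
rewrite -ltey => Hoo.
have key e : (0 < e)%R -> hausdorff_content s e A + hausdorff_content s e B <=
    hausdorff_measure s (A `|` B).
  move=> e0; pose f := Num.min d e.
  have f0 : (0 < f)%R by rewrite lt_min d0.
  apply: le_trans (le_hausdorff_measure_content s _ f0).
  apply: le_trans (@hausdorff_content_separated s f A B f0 _); last first.
    by move=> x y Ax By; rewrite lte_fin (le_lt_trans _ (AB _ _ Ax By))// ge_min lexx.
  by apply: leeD; apply: hausdorff_content_antimono; rewrite ge_min lexx orbT.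
have finA : hausdorff_measure s A \is a fin_num.
  rewrite ge0_fin_numE ?hausdorff_measure_ge0// (le_lt_trans _ Hoo)//.
  by apply: le_hausdorff_measure => x; left.
rewrite -leeBrDl//; apply: ge_ereal_sup => _ [d1 d10 <-].
have finB : hausdorff_content s d1 B \is a fin_num.
  rewrite ge0_fin_numE ?hausdorff_content_ge0// (le_lt_trans _ Hoo)//.
  apply: le_trans (le_hausdorff_measure_content s _ d10) _.
  by apply: le_hausdorff_measure => x; right.
rewrite leeBrDl// -leeBrDr//; apply: ge_ereal_sup => _ [d2 d20 <-].
rewrite leeBrDr//; pose f := Num.min d1 d2.
have f0 : (0 < f)%R by rewrite lt_min d10.
apply: le_trans (key _ f0).
by apply: leeD; apply: hausdorff_content_antimono; rewrite ge_min lexx ?orbT.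
Qed.

End HausdorffMeasure.

(** * Dyadic cubes and measurability of half-spaces *)

Section DyadicCubes.
Context (R : realType) (n : nat).
Implicit Types (x y : 'rV[R]_n) (z : {ffun 'I_n -> int}).

(** Cubes are defined as the fibres of this map, so that those of one level form a partition by
    construction. *)
Definition dyadic_index k x : {ffun 'I_n -> int} :=
  [ffun j => Num.floor (2 ^+ k * x 0 j)].

Definition dyadic_cube k z : set 'rV[R]_n := [set x | dyadic_index k x = z].

Lemma dyadic_cubeE k z : dyadic_cube k z =
  [set x | forall j, (z j)%:~R / 2 ^+ k <= x 0 j < (z j + 1)%:~R / 2 ^+ k].
Proof.
have pow_gt0 : (0 : R) < 2 ^+ k by rewrite exprn_gt0.
apply/seteqP; split=> [x <- j|x xz].
  rewrite ffunE ler_pdivrMr// ltr_pdivlMr// !(mulrC (x 0 j)).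
  exact: floor_itv.
apply/ffunP => j; rewrite ffunE; apply: floor_def.
by have := xz j; rewrite ler_pdivrMr// ltr_pdivlMr// !(mulrC (x 0 j)).
Qed.

Lemma dyadic_cube_dist k z x y : dyadic_cube k z x -> dyadic_cube k z y ->
  forall j, `|x 0 j - y 0 j| <= (2 ^+ k)^-1.
Proof.
rewrite dyadic_cubeE => + + j => /(_ j)/andP[xl xu] /(_ j)/andP[yl yu].
move: xu yu; rewrite intrD mulrDl mul1r => xu yu.
by rewrite ler_norml; apply/andP; split; lra.
Qed.

Lemma dyadic_index_succ k x j :
  dyadic_index k x j = (dyadic_index k.+1 x j %/ 2)%Z.
Proof.
rewrite !ffunE exprS -mulrA; set t := 2 ^+ k * x 0 j.
apply: floor_def; have /andP[] := floor_itv (2 * t).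
set f := Num.floor _ => f1 f2.
have : (0 <= (f %% 2)%Z) by rewrite modz_ge0.
have : ((f %% 2)%Z <= 1) by rewrite -ltzD1 ltz_pmod.
have := divz_eq f 2; move: (f %/ 2)%Z (f %% 2)%Z => q r fE.
rewrite -!(ler_int R) => r1 r0; move: f1 f2; rewrite fE !intrD intrM.
by move=> f1 f2; apply/andP; split; lra.
Qed.

Lemma dyadic_index_sub k l x y : (k <= l)%N ->
  dyadic_index l x = dyadic_index l y -> dyadic_index k x = dyadic_index k y.
Proof.
move=> /subnK <-; elim: (l - k)%N => [//|m ih]; rewrite addSn => e; apply: ih.
by apply/ffunP => j; rewrite dyadic_index_succ [RHS]dyadic_index_succ e.
Qed.

Lemma pow2_inv_lt (e : R) : 0 < e -> exists k, (2 ^+ k)^-1 < e.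
Proof.
move=> e0; exists (Num.truncn e^-1).+1.
rewrite -[ltRHS]invrK ltf_pV2 ?posrE ?invr_gt0 ?exprn_gt0//.
apply: lt_trans (truncnS_gt _) _.
by rewrite -natrX ltr_nat ltn_expl.
Qed.

(** The index type is countable, so cubes generate the Borel sets. *)
Lemma open_bigcup_dyadic (O : set 'rV[R]_n) : open O ->
  O = \bigcup_(kz in [set kz : nat * {ffun 'I_n -> int} |
                      dyadic_cube kz.1 kz.2 `<=` O]) dyadic_cube kz.1 kz.2.
Proof.
move=> oO; apply/seteqP; split=> [x Ox|x [kz kzO]]; last exact: kzO.
have /nbhs_ballP[e /= e0 eO] := open_nbhs_nbhs (conj oO Ox).
have [k ke] := pow2_inv_lt e0.
exists (k, dyadic_index k x) => //= y yx; apply: eO; rewrite /ball/=; split => // i j.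
rewrite ord1 /ball/=; apply: le_lt_trans ke.
by apply: (@dyadic_cube_dist k (dyadic_index k x)).
Qed.

(** The sigma-algebra of the domain is arbitrary because this serves both for Borel maps and, with
    [f] the identity, for the Caratheodory sigma-algebra of [hausdorff_measure]. *)
Lemma measurable_preimage_open d (T : measurableType d) (f : T -> 'rV[R]_n) :
  (forall j (a : R), measurable [set t | f t 0 j < a]) ->
  forall O, open O -> measurable (f @^-1` O).
Proof.
move=> mf O /open_bigcup_dyadic ->; rewrite preimage_bigcup bigcup_mkcond.
apply: countable_bigcupT_measurable => // -[k z]; case: ifPn => // _ /=.
rewrite dyadic_cubeE.
rewrite (_ : _ @^-1` _ = \bigcap_j ([set t | f t 0 j < (z j + 1)%:~R / 2 ^+ k] `\`
    [set t | f t 0 j < (z j)%:~R / 2 ^+ k])); last first.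
  apply/seteqP; split=> [t /= h j _|t h j].
    by have /andP[h1 h2] := h j; split => //=; apply/negP; rewrite -leNgt.
  by have [/= -> /negP] := h j I; rewrite -leNgt => ->.
apply: fin_bigcap_measurable; first exact: finite_finset.
by move=> j _; apply: measurableD.
Qed.

End DyadicCubes.

Notation borel R n := (g_sigma_algebraType (@open 'rV[R]_n)).

Section HausdorffBorel.
Context (R : realType) (n : nat).
Implicit Types (A X : set 'rV[R]_n) (s : nat).
Local Open Scope ereal_scope.

(* The slabs [B i] between consecutive parallel hyperplanes approaching the
   boundary have summable measure, since [B i] and [B i.+2] are separated. *)
Lemma halfspace_caratheodory s j (a : R) :
  (@hausdorff_measure R n s).-caratheodory [set x : 'rV[R]_n | (x 0 j < a)%R].
Proof.
set H := @hausdorff_measure R n s; set S : set 'rV[R]_n := mkset _.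
apply: le_caratheodory_measurable => X.
have [HX|] := eqVneq (H X) +oo; first by rewrite [leRHS]HX leey.
rewrite -ltey => HX.
pose t k : R := (a - k.+1%:R^-1)%R.
have t_lt k : (t k < t k.+1)%R by rewrite /t ltrD2l ltrN2 ltf_pV2 ?posrE// ltr_nat.
pose A k := X `&` [set x | (x 0 j <= t k)%R].
pose B k := X `&` [set x | (t k < x 0 j <= t k.+1)%R].
have sep (C D : set 'rV[R]_n) (u v : R) : (u < v)%R -> C `|` D `<=` X ->
    (forall x, C x -> (x 0 j <= u)%R) -> (forall x, D x -> (v <= x 0 j)%R) ->
    H C + H D <= H (C `|` D).
  move=> uv CDX Cu Dv.
  apply: (@hausdorff_measure_separated _ _ _ ((v - u) / 2)%R).
    by rewrite divr_gt0// subr_gt0.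
  move=> x y /Cu xu /Dv yv; apply: lt_le_trans (le_coord_enorm _ j).
  by rewrite !mxE ltr_normr; apply/orP; right; lra.
(* [A N] and [B N.+1] lie on either side of the slab [B N]; by separation the new term is absorbed
   into [H (A N)], which becomes [H (A N.+2)]. *)
have sumB N : \sum_(0 <= i < N.+1) H (B i) <= H (A N) + H (A N.+1).
  elim: N => [|N ih].
    rewrite big_nat1 -[leLHS]add0e; apply: leeD; first exact: outer_measure_ge0.
    by apply: le_outer_measure => x [Xx /= /andP[_ xN]].
  rewrite big_nat_recr//=; apply: (le_trans (leeD ih (le_refl _))).
  rewrite addeAC addeC; apply: leeD => //.
  apply: le_trans (sep _ _ (t N) (t N.+1) _ _ _ _) _ => //.
  - by move=> x [[]|[]].
  - by move=> x [].
  - by move=> x [_ /= /andP[/ltW]].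
  - apply: le_outer_measure => x [[Xx /= xN]|[Xx /= /andP[_ xN]]]; split => //=.
    by rewrite (le_trans xN)// (le_trans (ltW (t_lt _)))// ltW.
have AX k : H (A k) <= H X by apply: le_outer_measure; exact: subIsetl.
have sumBoo : \sum_(0 <= i <oo) H (B i) < +oo.
  apply: (@le_lt_trans _ _ (H X + H X)); last by rewrite lte_add_pinfty.
  apply: lime_le; first by apply: is_cvg_nneseries => *; exact: outer_measure_ge0.
  near=> N.
  apply: (@le_trans _ _ (\sum_(0 <= i < N.+1) H (B i))).
    by rewrite big_nat_recr//= leeDl// outer_measure_ge0.
  by apply: le_trans (sumB N) _; exact: leeD.
have tail_cvg := nneseries_tail_cvg sumBoo (fun k _ => outer_measure_ge0 H (B k)).
(* Up to the slabs from [N] on, X within S is [A N], which the gap between [t N] and [a] separates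
   from the complement of S. *)
have tail N : H (X `&` S) + H (X `&` ~` S) <= H X + \sum_(N <= k <oo) H (B k).
  have XS : H (X `&` S) <= H (A N) + \sum_(N <= k <oo) H (B k).
    apply: (@le_trans _ _ (H (A N `|` \bigcup_(k in ~` `I_N) B k))).
      apply: le_outer_measure => x [Xx /= xa].
      have [xN|Nx] := leP (x 0%R j) (t N); [by left; split|right].
      have [k xk] : exists k, (x 0%R j <= t k)%R.
        have a0 : (0 < a - x 0 j)%R by rewrite subr_gt0.
        exists (Num.truncn (a - x 0%R j)^-1)%R; rewrite /t lerBrDr addrC -lerBrDr.
        rewrite -[leRHS]invrK lef_pV2 ?posrE ?invr_gt0//.
        exact/ltW/truncnS_gt.
      have : exists k, (x 0%R j <= t k)%R by exists k.
      move=> /[dup] ex; case: (ex_minnP ex) => m xm mmin _.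
      have Nm : (N < m)%N.
        rewrite ltnNge; apply/negP => mN.
        have : (t m <= t N)%R by rewrite /t lerD2l lerN2 lef_pV2 ?posrE// ler_nat.
        by move=> /(le_trans xm); rewrite leNgt Nx.
      case: m Nm xm mmin => // m Nm xm mmin.
      exists m; first by move=> /=; rewrite ltnNge -ltnS Nm.
      split => //=; rewrite xm andbT ltNge; apply/negP => /mmin.
      by rewrite ltnn.
    apply: le_trans (outer_measureU2 _ _ _) _; apply: leeD => //.
    exact: outer_measure_sigma_subadditive_tail.
  apply: (le_trans (leeD XS (le_refl _))); rewrite addeAC; apply: leeD => //.
  apply: le_trans (sep _ _ (t N) a _ _ _ _) _.
  - by rewrite /t gtrDl oppr_lt0.
  - by move=> x [[]|[]].
  - by move=> x [].
  - by move=> x [_ /negP]; rewrite -leNgt.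
  - by apply: le_outer_measure => x [[]|[]].
have HXfin : H X \is a fin_num by rewrite ge0_fin_numE// outer_measure_ge0.
rewrite -[leRHS]adde0; apply: (cvge_to_ge (cvgeD _ (cvg_cst (H X)) tail_cvg)).
  by rewrite fin_num_adde_defr.
exact: nearW.
Unshelve. all: by end_near. Qed.

End HausdorffBorel.

Section FiniteUnions.
Context (R : realType).
Local Open Scope ereal_scope.

Let setT_enum (I : finType) : [set: I] = [set` index_enum I].
Proof. by apply/seteqP; split => // i _ /=; rewrite mem_index_enum. Qed.

Lemma outer_measure_fintype T (mu : {outer_measure set T -> \bar R})
    (I : finType) (F : I -> set T) : mu (\bigcup_i F i) <= \sum_i mu (F i).
Proof.
rewrite setT_enum bigcup_seq; elim: (index_enum I) => [|i s ih].
  by rewrite !big_nil outer_measure0.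
rewrite !big_cons; apply: le_trans (outer_measureU2 _ _ _) _.
exact: leeD.
Qed.

Lemma measure_fibers d (T : measurableType d) (mu : {measure set T -> \bar R})
    (I : finType) (f : T -> I) (A : set T) :
  (forall i, measurable (A `&` f @^-1` [set i])) ->
  mu A = \sum_i mu (A `&` f @^-1` [set i]).
Proof.
move=> mA; rewrite -[in LHS](_ : \bigcup_i (A `&` f @^-1` [set i]) = A).
  rewrite measure_fin_bigcup//; first last.
  - by move=> i j _ _ [x [[_ <-] [_ <-]]].
  - exact: finite_finset.
  - by rewrite setT_enum -fsbig_seq ?index_enum_uniq.
by apply/seteqP; split=> [x [i _ []]|x Ax] //; exists (f x).
Qed.

End FiniteUnions.

Section DyadicChildren.
Context (R : realType) (n : nat).
Implicit Types (x y : 'rV[R]_n) (z : {ffun 'I_n -> int}).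

Definition dyadic_child z (b : {ffun 'I_n -> bool}) : {ffun 'I_n -> int} :=
  [ffun j => z j * 2 + (b j : nat)%:Z].

Definition dyadic_parity k x : {ffun 'I_n -> bool} :=
  [ffun j => (dyadic_index k x j %% 2)%Z == 1].

(** The children of a cube appear as the fibres of one finite-valued map, the form that
    [measure_fibers] counts. *)
Lemma dyadic_childE k z b :
  dyadic_cube k.+1 (dyadic_child z b) =
  dyadic_cube k z `&` dyadic_parity k.+1 @^-1` [set b] :> set 'rV[R]_n.
Proof.
have idx x j : dyadic_index k.+1 x j = dyadic_index k x j * 2
    + ((dyadic_parity k.+1 x j) : nat)%:Z.
  rewrite (dyadic_index_succ k) [LHS](divz_eq _ 2) [dyadic_parity _ _ _]ffunE; congr (_ + _).
  have := @ltz_pmod (dyadic_index k.+1 x j) 2 isT.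
  have := @modz_ge0 (dyadic_index k.+1 x j) 2 isT.
  by move: (_ %% 2)%Z => r; case: r => [[|[|m]]|m].
apply/seteqP; split=> x.
  move=> xz; have e j : z j = dyadic_index k x j /\ b j = dyadic_parity k.+1 x j.
    have := congr1 (fun f : {ffun 'I_n -> int} => f j) xz; rewrite idx [dyadic_child _ _ _]ffunE.
    by case: (b j); case: (dyadic_parity k.+1 x j) => /= e; split => //; lia.
  by split; apply/ffunP => j; have [] := e j.
by move=> [/= xz xb]; apply/ffunP => j; rewrite idx [dyadic_child _ _ _]ffunE xb xz.
Qed.

Lemma dyadic_cube_children k z :
  dyadic_cube k z = \bigcup_b dyadic_cube k.+1 (dyadic_child z b) :> set 'rV[R]_n.
Proof.
apply/seteqP; split=> [x xz|x [b _]]; last by rewrite dyadic_childE => -[].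
by exists (dyadic_parity k.+1 x) => //; rewrite dyadic_childE.
Qed.

Lemma dyadic_cube_translate k z : dyadic_cube k z =
  [set x + \row_j ((z j)%:~R / 2 ^+ k) | x in dyadic_cube k [ffun=> 0]]
  :> set 'rV[R]_n.
Proof.
rewrite !dyadic_cubeE; apply/seteqP; split=> [x xz|_ [x xz <-] j]; last first.
  have := xz j; rewrite ffunE !mxE !intrD !mulrDl.
  by move=> /andP[t1 t2]; apply/andP; split; lra.
exists (x - \row_j ((z j)%:~R / 2 ^+ k)); last by rewrite subrK.
move=> j; have := xz j; rewrite ffunE !mxE !intrD !mulrDl.
by move=> /andP[t1 t2]; apply/andP; split; lra.
Qed.

End DyadicChildren.

Section HausdorffBorelMeasure.
Context (R : realType) (n : nat).
Implicit Types (A B : set 'rV[R]_n) (s : nat).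
Local Open Scope ereal_scope.

Lemma borel_caratheodory s A : measurable (A : set (borel R n)) ->
  (@hausdorff_measure R n s).-caratheodory A.
Proof.
pose mu := @hausdorff_measure R n s : {outer_measure set 'rV[R]_n -> \bar R}.
suff sub : <<s @open 'rV[R]_n >> `<=` mu.-cara.-measurable by move=> /sub.
apply: smallest_sub.
  exact: (@sigma_algebra_measurable _ (caratheodory_type mu)).
move=> O oO.
apply: (@measurable_preimage_open R n _ (caratheodory_type mu) id) => // j a.
exact: halfspace_caratheodory.
Qed.

Definition borel_hausdorff s : set (borel R n) -> \bar R :=
  @hausdorff_measure R n s.

Let borel_hausdorff_sigma_additive s : semi_sigma_additive (borel_hausdorff s).
Proof.
pose mu := @hausdorff_measure R n s : {outer_measure set 'rV[R]_n -> \bar R}.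
move=> F mF tF mUF.
have cF k : mu.-cara.-measurable (F k) by apply: borel_caratheodory; exact: mF.
have cUF : mu.-cara.-measurable (\bigcup_k F k) by exact: borel_caratheodory.
exact: (@caratheodory_measure_sigma_additive R _ mu F cF tF cUF).
Qed.

HB.instance Definition _ s := isMeasure.Build _ _ _ (borel_hausdorff s)
  (hausdorff_measure0 R n s) (@hausdorff_measure_ge0 R n s)
  (@borel_hausdorff_sigma_additive s).

Lemma hausdorff_measure_lipschitz s (f : 'rV[R]_n -> 'rV[R]_n) A :
  (forall x y, A x -> A y -> (enorm (f x - f y) <= enorm (x - y))%R) ->
  hausdorff_measure s (f @` A) <= hausdorff_measure s A.
Proof.
move=> lipf; apply: ge_ereal_sup => _ [d d0 <-].
apply: le_trans (le_hausdorff_measure_content s A d0).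
apply: le_ereal_inf_tmp => _ [U [AU Ud] <-].
(* The intersection is taken because [f] is controlled on [A] only. *)
pose V k := f @` (U k `&` A).
have VU k : V k !=set0 -> U k !=set0 /\ ediam (V k) <= ediam (U k).
  move=> [_ [x [Ux _] _]]; split; first by exists x.
  apply: ediam_le => _ _ [y [Uy Ay] <-] [w [Uw Aw] <-].
  by apply: le_trans (le_ediam Uy Uw); rewrite lee_fin lipf.
apply: (@le_trans _ _ (\sum_(0 <= k <oo) hausdorff_gauge s (V k))).
  apply: ereal_inf_lbound; exists V => //; split=> [_ [x Ax <-]|k].
    by have [k _ Ux] := AU _ Ax; exists k => //; exists x.
  have [|/set0P] := eqVneq (V k) set0; first by move=> ->; apply: ediam_le => x y [].
  by move=> /VU[_ /le_trans]; apply.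
apply: lee_nneseries => k _ *; first exact: hausdorff_gauge_ge0.
exact: hausdorff_gauge_le (VU k) (Ud k).
Qed.

Lemma hausdorff_measure_translate s v A :
  hausdorff_measure s [set (x + v)%R | x in A] = hausdorff_measure s A.
Proof.
have le w B : hausdorff_measure s [set (x + w)%R | x in B] <= hausdorff_measure s B.
  by apply: hausdorff_measure_lipschitz => x y _ _; rewrite opprD addrACA subrr addr0.
apply/eqP; rewrite eq_le le /=; apply: le_trans (le (- v)%R _).
by apply: le_hausdorff_measure => x Ax; exists (x + v)%R; [exists x|rewrite addrK].
Qed.

Lemma hausdorff_gauge_le_bound s A (d : R) : (0 <= d)%R -> ediam A <= d%:E ->
  hausdorff_gauge s A <= (hausdorff_cst R s * (d / 2) ^+ s)%:E.
Proof.
move=> d0 Ad; rewrite /hausdorff_gauge; have c0 := hausdorff_cst_gt0 R s.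
case: ifPn => [_|/set0P A0]; rewrite lee_fin.
  by rewrite mulr_ge0 ?(ltW c0)// exprn_ge0// divr_ge0.
have dA := ediam_ge0 A0.
have fA : ediam A \is a fin_num by rewrite ge0_fin_numE// (le_lt_trans Ad)// ltry.
rewrite ler_wpM2l ?(ltW c0)// lerXn2r ?nnegrE ?divr_ge0 ?fine_ge0//.
by rewrite ler_wpM2r// -lee_fin fineK.
Qed.

Lemma hausdorff_content_le_gauge s A (d : R) : (0 <= d)%R -> ediam A <= d%:E ->
  hausdorff_content s d A <= hausdorff_gauge s A.
Proof.
move=> d0 Ad; pose U (k : nat) : set 'rV[R]_n := if k is 0%N then A else set0.
apply: (@le_trans _ _ (\sum_(0 <= k <oo) hausdorff_gauge s (U k))).
  apply: ereal_inf_lbound; exists U => //; split; first by move=> x; exists 0%N.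
  by case=> // k; apply: ediam_le => x y [].
rewrite nneseries_recl//; last by move=> k _; exact: hausdorff_gauge_ge0.
rewrite eseries_cond eseries0 ?adde0// => -[|k] // _ _.
exact: hausdorff_gauge0.
Qed.

Lemma ediam_dyadic_cube k z :
  ediam (dyadic_cube k z : set 'rV[R]_n) <= (n%:R / 2 ^+ k)%:E.
Proof.
apply: ediam_le => x y xz yz; rewrite lee_fin; apply: enorm_le_coord.
  by rewrite invr_ge0 exprn_ge0.
by move=> j; rewrite !mxE; exact: dyadic_cube_dist xz yz j.
Qed.

Let two_pow_gt0 k : (0 < 2 ^+ k :> R)%R. Proof. by rewrite exprn_gt0. Qed.

Lemma hausdorff_dyadic_cube_lty k z :
  hausdorff_measure n (dyadic_cube k z : set 'rV[R]_n) < +oo.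
Proof.
pose c : R := (hausdorff_cst R n * (n%:R / 2 ^+ k / 2) ^+ n)%R.
apply: (@le_lt_trans _ _ c%:E); last exact: ltry.
apply: ge_ereal_sup => _ [d d0 <-].
(* The right-hand side bounds the gauge of one cube of level [l]. Subdivision into 2^n cubes of half
   the side reproduces the same total, so the bound survives the [m] subdivisions that bring the
   diameters below [d]. *)
have main m l y : (n%:R / 2 ^+ (l + m) <= d)%R ->
    hausdorff_content n d (dyadic_cube l y : set 'rV[R]_n) <=
    (hausdorff_cst R n * (n%:R / 2 ^+ l / 2) ^+ n)%:E.
  elim: m l y => [|m ih] l y nd.
    rewrite addn0 in nd.
    have dd : ediam (dyadic_cube l y : set 'rV[R]_n) <= d%:E.
      by apply: le_trans (ediam_dyadic_cube _ _) _; rewrite lee_fin.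
    apply: le_trans (hausdorff_content_le_gauge n (ltW d0) dd) _.
    apply: hausdorff_gauge_le_bound (ediam_dyadic_cube _ _).
    by rewrite divr_ge0// ltW.
  rewrite dyadic_cube_children; apply: le_trans (outer_measure_fintype _ _) _.
  apply: (@le_trans _ _ (\sum_(b : {ffun 'I_n -> bool})
      (hausdorff_cst R n * (n%:R / 2 ^+ l.+1 / 2) ^+ n)%:E)).
    by apply: lee_sum => b _; apply: ih; rewrite addSnnS.
  rewrite sumEFin lee_fin sumr_const card_ffun card_bool card_ord.
  rewrite -[leLHS]mulr_natl natrX [leLHS]mulrCA -exprMn exprS invfM.
  by rewrite le_eqVlt; apply/orP; left; apply/eqP; congr (_ * _ ^+ _)%R; field; rewrite gt_eqF.
have [m md] : exists m, (n%:R / 2 ^+ m < d)%R.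
  have [->|n0] := eqVneq n 0%N; first by exists 0%N; rewrite mul0r.
  have n0' : (0 < n%:R :> R)%R by rewrite ltr0n lt0n.
  have [m md] := @pow2_inv_lt R _ (divr_gt0 d0 n0').
  by exists m; rewrite mulrC -ltr_pdivlMr.
apply: (main m); rewrite addnC exprD invfM mulrA ltW//.
apply: le_lt_trans md; rewrite ler_piMr ?divr_ge0 ?(ltW (two_pow_gt0 _))//.
by rewrite invf_le1// exprn_ege1// ler1n.
Qed.

End HausdorffBorelMeasure.

(** * Translation-invariant measures and linear maps *)

Section TranslationInvariantMeasures.
Context (R : realType) (n : nat).
Local Open Scope ereal_scope.

Lemma borel_coord (j : 'I_n) (U : set R) : open U ->
  measurable ([set x | U (x 0%R j)] : set (borel R n)).
Proof.
move=> oU; apply: sub_sigma_algebra.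
by apply: (@open_comp _ _ (fun x : 'rV[R]_n => x 0%R j)) => // x _; exact: coord_continuous.
Qed.

Lemma measurable_dyadic_cube k z : measurable (dyadic_cube k z : set (borel R n)).
Proof.
rewrite (_ : dyadic_cube k z = \bigcap_j
   ([set x : 'rV[R]_n | (x 0 j < (z j + 1)%:~R / 2 ^+ k)%R] `\`
    [set x : 'rV[R]_n | (x 0 j < (z j)%:~R / 2 ^+ k)%R])); last first.
  rewrite dyadic_cubeE; apply/seteqP; split=> [x /= h j _|x h j].
    by have /andP[h1 h2] := h j; split => //=; apply/negP; rewrite -leNgt.
  by have [/= -> /negP] := h j I; rewrite -leNgt => ->.
apply: fin_bigcap_measurable; first exact: finite_finset.
by move=> j _; apply: measurableD; exact: (borel_coord j (@open_lt R _)).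
Qed.

Definition translation_invariant (mu : set 'rV[R]_n -> \bar R) :=
  forall v (A : set (borel R n)), measurable A ->
    mu [set (x + v)%R | x in A] = mu A.

Lemma translation_invariant_cube (m : {measure set (borel R n) -> \bar R}) k z :
  translation_invariant m ->
  m (dyadic_cube k z) = m (dyadic_cube k [ffun=> 0%R]).
Proof.
by move=> mT; rewrite dyadic_cube_translate mT//; exact: measurable_dyadic_cube.
Qed.

Lemma translation_invariant_cube_succ (m : {measure set (borel R n) -> \bar R}) k :
  translation_invariant m ->
  m (dyadic_cube k [ffun=> 0%R]) =
  (2 ^ n)%:R%:E * m (dyadic_cube k.+1 [ffun=> 0%R]).
Proof.
move=> mT; rewrite (measure_fibers m (f := @dyadic_parity R n k.+1)) => [|b]; last first.
  by rewrite -dyadic_childE; exact: measurable_dyadic_cube.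
rewrite (eq_bigr (fun=> m (dyadic_cube k.+1 [ffun=> 0%R]))) => [|b _]; last first.
  by rewrite -dyadic_childE [LHS]translation_invariant_cube.

by rewrite sumr_const card_ffun card_bool card_ord mule_natl.
Qed.

(** By invariance all cubes of one level have the same measure, and halving the side divides it by
    2^n, so the unit cube determines both measures on all dyadic cubes. With the empty set these
    form a pi-system generating the Borel sets. *)
Lemma translation_invariant_unique (m1 m2 : {measure set (borel R n) -> \bar R}) :
  translation_invariant m1 -> translation_invariant m2 ->
  m1 (dyadic_cube 0 [ffun=> 0%R]) = m2 (dyadic_cube 0 [ffun=> 0%R]) ->
  m1 (dyadic_cube 0 [ffun=> 0%R]) < +oo ->
  forall A, measurable A -> m1 A = m2 A.
Proof.
move=> T1 T2 m12 m1oo.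
have two_neq0 : (2 ^ n)%:R != 0%R :> R by rewrite pnatr_eq0 -lt0n expn_gt0.
have cube_eq k : m1 (dyadic_cube k [ffun=> 0%R]) = m2 (dyadic_cube k [ffun=> 0%R]).
  elim: k => // k.
  rewrite (translation_invariant_cube_succ k T1) (translation_invariant_cube_succ k T2) => e.
  have := congr1 (fun t => ((2 ^ n)%:R^-1)%:E * t) e.
  by rewrite !muleA -!EFinM mulVf// !mul1e.
pose G := [set A : set (borel R n) | A = set0 \/ exists k z, A = dyadic_cube k z].
(* An enumeration of the unit cubes, with the empty set at numbers that code no index: the
   sigma-finite cover. *)
pose g k : set (borel R n) :=
  if @unpickle {ffun 'I_n -> int} k is Some z then dyadic_cube 0 z else set0.
have Gm : G `<=` measurable.
  by move=> _ [->//|[k [z ->]]]; exact: measurable_dyadic_cube.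
have eqG A : G A -> m1 A = m2 A.
  move=> [->|[k [z ->]]]; first by rewrite !measure0.
  by rewrite (translation_invariant_cube k z T1) (translation_invariant_cube k z T2).
apply: (measure_unique G g) => //.
- apply/seteqP; split; last first.
    exact: (smallest_sub (@sigma_algebra_measurable _ (borel R n)) Gm).
  apply: (smallest_sub (smallest_sigma_algebra _ _)).
  move=> O oO; rewrite (open_bigcup_dyadic oO) bigcup_mkcond.
  apply: (@countable_bigcupT_measurable _ (g_sigma_algebraType G)) => // -[k z].
  case: ifPn => _ //; apply: sub_sigma_algebra; right; by exists k, z.
(* Two dyadic cubes are disjoint or nested, so their intersection stays in [G]. *)
- have nested k l y z : (k <= l)%N ->
      G (dyadic_cube k y `&` dyadic_cube l z).
    move=> kl; have [[x [xy xz]]|no] := pselect (exists x : 'rV[R]_n,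
        dyadic_cube k y x /\ dyadic_cube l z x); last first.
      by left; apply/seteqP; split => // x [xy xz]; apply: no; exists x.
    right; exists l, z; apply/setIidPr => w wz; rewrite -xy.
    by apply: dyadic_index_sub kl _; rewrite wz xz.
  move=> _ _ [->|[k [y ->]]] [->|[l [z ->]]]; rewrite ?setI0 ?set0I; try by left.
  by have [/nested|/ltnW /nested] := leqP k l; last rewrite setIC; apply.
- by move=> k; rewrite /g; case: unpickle => [z|]; [right; exists 0%N, z|left].
- apply/seteqP; split => // x _; exists (pickle (dyadic_index 0 x)) => //.
  by rewrite /g pickleK.
- move=> k; rewrite /g; case: unpickle => [z|]; rewrite ?measure0//.
  by rewrite (translation_invariant_cube 0 z T1).
Qed.

End TranslationInvariantMeasures.

(** * Positivity of the Hausdorff measure of the unit cube *)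

Section BoxCovers.
Context (R : realType) (n : nat).
Local Open Scope ereal_scope.

(* The coordinates are integrated out one at a time. *)
Lemma box_cover_volume (c : nat -> R) (lo hi : nat -> 'I_n -> R) :
  (forall k, 0 <= c k)%R -> (forall k j, lo k j <= hi k j)%R ->
  (forall x : 'I_n -> R, (forall j, 0 <= x j < 1)%R ->
    1 <= \sum_(0 <= k <oo) (c k * \prod_j \1_(`[lo k j, hi k j]%classic) (x j))%:E) ->
  1 <= \sum_(0 <= k <oo) (c k * \prod_j (hi k j - lo k j))%:E.
Proof.
move=> c0 lohi cov.
(* In [F r] the coordinates below [r] still carry indicators, while the others are already
   integrated to side lengths. *)
pose F (r : nat) (x : 'I_n -> R) k (j : 'I_n) : R :=
  if (j < r)%N then \1_(`[lo k j, hi k j]%classic) (x j) else (hi k j - lo k j)%R.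
have F0 r x k j : (0 <= F r x k j)%R by rewrite /F; case: ifP => _ //; rewrite subr_ge0.
suff main r : (r <= n)%N -> forall x : 'I_n -> R, (forall j, 0 <= x j < 1)%R ->
    1 <= \sum_(0 <= k <oo) (c k * \prod_j F (n - r)%N x k j)%:E.
  apply: le_trans (main n (leqnn n) (fun=> 0%R) _) _ => //.
    by move=> j; rewrite lexx ltr01.
  rewrite subnn; under eq_eseriesr do under eq_bigr do rewrite /F ltn0.
  exact: lexx.
elim: r => [_ x x01|r ih rn x x01].
  rewrite subn0; apply: le_trans (cov x x01) _.
  under [leRHS]eq_eseriesr do under eq_bigr do rewrite /F ltn_ord.
  exact: lexx.
set m := (n - r.+1)%N.
have mr : (n - r)%N = m.+1 by rewrite /m; lia.
have mn : (m < n)%N by rewrite /m; lia.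
pose i := Ordinal mn.
pose xt (t : R) (j : 'I_n) := if j == i then t else x j.
pose C k : R := (c k * \prod_(j | j != i) F m x k j)%R.
have C0 k : (0 <= C k)%R by rewrite mulr_ge0// prodr_ge0.
pose I k : set R := `[lo k i, hi k i]%classic.
have E t k : (c k * \prod_j F m.+1 (xt t) k j)%:E = (C k)%:E * (\1_(I k) t)%:E.
  rewrite -EFinM (bigD1 i)//= {1}/F ltnSn /xt eqxx mulrCA mulrC /C; congr (_ * _)%:E.
  congr (_ * _)%R; apply: eq_bigr => j ji; rewrite /F (negbTE ji) ltnS.
  by rewrite (leq_eqVlt j) (_ : (j == m :> nat) = false)//; apply/negbTE.
pose fI k : R -> \bar R := fun t => (\1_(I k) t)%:E.
have mI k : measurable_fun setT (fI k).
  by apply/measurable_EFinP/measurable_indic; exact: measurable_itv.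
pose D : set R := `[0%R, 1%R[%classic.
have mD : measurable D by exact: measurable_itv.
have lD : lebesgue_measure D = 1.
  by rewrite /D lebesgue_measure_itv/= lte_fin ltr01 sube0.
have -> : 1 = \int[lebesgue_measure]_(t in D) (cst 1 t) :> \bar R.
  by rewrite integral_cst// mul1e; exact/esym.
(* The inductive bound is integrated over coordinate [i] in [0, 1), of length 1; each indicator then
   contributes at most the length of its interval. *)
apply: (@le_trans _ _ (\int[lebesgue_measure]_(t in D)
    \sum_(0 <= k <oo) ((C k)%:E * (\1_(I k) t)%:E))).
  apply: ge0_le_integral => //.
  - apply: ge0_emeasurable_sum => [k t _ _|k _]; first by rewrite mule_ge0// lee_fin.
    by apply: measurable_funeM; apply: measurable_funS (mI k).
  - move=> t /=; rewrite /D/= in_itv/= => t01.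
    under eq_eseriesr do rewrite -E.
    rewrite -mr; apply: ih; first exact: ltnW.
    by move=> j; rewrite /xt; case: ifP.
rewrite integral_nneseries//; first last.
- by move=> k t _; rewrite mule_ge0// lee_fin.
- by move=> k; apply: measurable_funeM; apply: measurable_funS (mI k).
apply: lee_nneseries => [k _ _|k _].
  by apply: integral_ge0 => t _; rewrite mule_ge0// lee_fin.
rewrite ge0_integralZl_EFin//; last by apply: measurable_funS (mI k).
rewrite integral_indic//; last exact: measurable_itv.
apply: (@le_trans _ _ ((C k)%:E * (hi k i - lo k i)%:E)).
  apply: lee_wpmul2l; first by rewrite lee_fin.
  apply: (@le_trans _ _ (lebesgue_measure (I k))).
    apply: le_measure; rewrite ?inE//; last exact: measurable_itv.
    by apply: measurableI => //; exact: measurable_itv.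
  rewrite /I lebesgue_measure_itv/=; case: ifP => _; first by rewrite EFinB.
  by rewrite lee_fin subr_ge0.
by rewrite -EFinM lee_fin (bigD1 i)//= {1}/F ltnn mulrCA mulrC.
Qed.

Lemma hausdorff_unit_cube_gt0 :
  0 < hausdorff_measure n (dyadic_cube 0 [ffun=> 0%R] : set 'rV[R]_n).
Proof.
(* A set of diameter D lies in a box of side 2 D around any of its points, and [e] times (2 D)^n is
   exactly its gauge. *)
pose e : R := (hausdorff_cst R n / 4 ^+ n)%R.
have e0 : (0 < e)%R by rewrite divr_gt0 ?hausdorff_cst_gt0// exprn_gt0.
apply: (@lt_le_trans _ _ e%:E); first by rewrite lte_fin.
apply: le_trans (le_hausdorff_measure_content _ _ ltr01).
apply: le_ereal_inf_tmp => _ [U [QU Ud] <-].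
have Uget k : U k !=set0 -> U k (xget 0%R (U k)) by move=> [x Ux]; apply: xgetPex; exists x.
pose p k : 'rV[R]_n := xget 0%R (U k).
(* This factor removes the empty members: their gauge is 0, but for n = 0 the empty product would
   count them as 1. *)
pose c k : R := if pselect (U k !=set0) then 1%R else 0%R.
pose D k : R := fine (ediam (U k)).
have D0 k : (0 <= D k)%R.
  rewrite /D; have [->|/set0P U0] := eqVneq (U k) set0; last by rewrite fine_ge0// ediam_ge0.
  rewrite (_ : ediam _ = -oo)//; apply/eqP; rewrite -leeNy_eq.
  by apply: ediam_le => x y [].
pose lo k j := (p k 0%R j - D k)%R; pose hi k j := (p k 0%R j + D k)%R.
have hilo k j : (hi k j - lo k j = D k * 2)%R by rewrite /lo /hi; ring.
have : 1 <= \sum_(0 <= k <oo) (c k * \prod_j (hi k j - lo k j))%:E.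
  apply: box_cover_volume.
  - by move=> k; rewrite /c; case: pselect.
  - by move=> k j; rewrite /lo /hi lerBlDr -addrA lerDl addr_ge0.
  move=> x x01; pose y : 'rV[R]_n := (\row_j x j)%R.
  have [|k _ Uky] := QU y.
    by rewrite dyadic_cubeE => j; rewrite ffunE mxE expr0 !divr1 add0r; exact: x01.
  have Uk0 : U k !=set0 by exists y.
  apply: (@le_trans _ _ (c k * \prod_j \1_(`[lo k j, hi k j]%classic) (x j))%:E).
    rewrite lee_fin /c; case: pselect => //= _; rewrite mul1r big1// => j _.
    rewrite indicE mem_set//= in_itv/= /lo /hi.
    have : (`|x j - p k 0 j| <= D k)%R.
      apply: (@le_trans _ _ (enorm (y - p k)%R)).
        by apply: le_trans _ (le_coord_enorm _ j); rewrite !mxE.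
      rewrite -lee_fin /D fineK; first exact: le_ediam (Uget k Uk0).
      by rewrite ge0_fin_numE ?ediam_ge0// (le_lt_trans (Ud k))// ltry.
    by rewrite ler_norml => /andP[h1 h2]; apply/andP; split; lra.
  have c0 l : (0 <= c l)%R by rewrite /c; case: pselect.
  rewrite (@nneseriesD1 _ _ k)//; last first.
    by move=> l _; rewrite lee_fin mulr_ge0// prodr_ge0.
  by rewrite leeDl//; apply: nneseries_ge0 => l _ _; rewrite lee_fin mulr_ge0// prodr_ge0.
move=> cov; rewrite -[leLHS]mule1.
apply: (le_trans (lee_wpmul2l (ltW _ : 0 <= e%:E) cov)); first by rewrite lte_fin.
rewrite -nneseriesZl//; last first.
  move=> k _; rewrite lee_fin mulr_ge0//; first by rewrite /c; case: pselect.
  by apply: prodr_ge0 => j _; rewrite hilo mulr_ge0.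
apply: lee_nneseries => [k _ _|k _].
  rewrite mule_ge0 ?lee_fin ?(ltW e0)// mulr_ge0//; first by rewrite /c; case: pselect.
  by apply: prodr_ge0 => j _; rewrite hilo mulr_ge0.
rewrite -EFinM /c; case: pselect => [Uk0|_] /=; last first.
  by rewrite mul0r mulr0 hausdorff_gauge_ge0.
rewrite /hausdorff_gauge; move/set0P : Uk0 => /negbTE ->; rewrite lee_fin mul1r.
rewrite (eq_bigr (fun=> (D k * 2)%R)) => [|j _]; last by rewrite hilo.
rewrite prodr_const card_ord /e -mulrA.
apply: ler_wpM2l; first exact/ltW/hausdorff_cst_gt0.
rewrite -exprVn -exprMn le_eqVlt; apply/orP; left; apply/eqP; congr (_ ^+ _)%R.
by rewrite -/(D k); field.
Qed.

End BoxCovers.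

(** * Borel maps and scaling under linear maps *)

Section BorelMaps.
Context (R : realType) (n : nat).

(** The bridge from estimates in the Euclidean norm to the topology, which comes from the sup norm;
    the factor n in [enorm_le_norm] explains the denominator of [d]. *)
Lemma lipschitz_continuous (V : normedModType R) (f : 'rV[R]_n -> V) (c : R) :
  (forall x y, `|f x - f y| <= c * enorm (x - y)) -> continuous f.
Proof.
move=> lipf x.
apply: (proj2 (@cvgrPdist_lt _ _ _ (nbhs x) (nbhs_filter x) f (f x))) => e e0.
pose d := e / (`|c| * n%:R + 1).
have d0 : 0 < d by rewrite divr_gt0// ltr_wpDl// mulr_ge0.
apply/nbhs_ballP; exists d => //= y; rewrite -ball_normE /= => xy.
apply: le_lt_trans (lipf x y) _.
apply: (@le_lt_trans _ _ ((`|c| * n%:R) * `|x - y|)).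
  rewrite -mulrA; apply: (@le_trans _ _ (`|c| * enorm (x - y))).
    by rewrite ler_wpM2r ?enorm_ge0// ler_norm.
  by rewrite ler_wpM2l// enorm_le_norm.
move: xy; rewrite /d ltr_pdivlMr ?ltr_wpDl ?mulr_ge0//; apply: le_lt_trans.
by rewrite mulrC ler_wpM2l// lerDl.
Qed.

Lemma dot_continuous (a : 'rV[R]_n) : continuous (dot a : 'rV[R]_n -> R).
Proof.
apply: (@lipschitz_continuous R^o _ (enorm a)) => x y /=.
rewrite ler_norml lerNl opprB -dotBr -dotBr dot_le_enorm andbT.
by rewrite enorm_distC dot_le_enorm.
Qed.

Lemma open_borel (O : set 'rV[R]_n) : open O -> measurable (O : set (borel R n)).
Proof. exact: sub_sigma_algebra. Qed.

Lemma closed_borel (O : set 'rV[R]_n) : closed O -> measurable (O : set (borel R n)).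
Proof.
by move=> cO; rewrite -(setCK O); apply: measurableC; apply: open_borel; exact: closed_openC.
Qed.

Lemma borel_measurable_fun d (T : measurableType d) (f : T -> borel R n) :
  (forall j (a : R), measurable [set t | (f t : 'rV[R]_n) 0 j < a]) ->
  measurable_fun setT f.
Proof.
move=> mf; apply: measurability => // _ [U oU <-]; rewrite setTI.
exact: measurable_preimage_open.
Qed.

Lemma mulmx_borel (M : 'M[R]_n) :
  measurable_fun setT ((fun x : 'rV[R]_n => x *m M) : borel R n -> borel R n).
Proof.
apply: borel_measurable_fun => j a.
have E (x : 'rV[R]_n) : (x *m M) 0 j = dot (col j M)^T x.
  by rewrite mxE; apply: eq_bigr => i _; rewrite !mxE mulrC.
rewrite (_ : [set _ | _] = [set x : 'rV[R]_n | dot (col j M)^T x < a]); last first.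
  by apply/seteqP; split => x /=; rewrite E.
apply: open_borel.
apply: (@open_comp _ _ (dot (col j M)^T) [set y | y < a] _ (@open_lt R a)) => x _.
exact: dot_continuous.
Qed.

Lemma mulmx_image_borel (M : 'M[R]_n) (A : set (borel R n)) :
  M \in unitmx -> measurable A -> measurable ([set x *m M | x in A] : set (borel R n)).
Proof.
move=> uM mA.
rewrite (_ : [set _ | _ in _] = (fun x : 'rV[R]_n => x *m invmx M) @^-1` A).
  by rewrite -[X in measurable X]setTI; exact: mulmx_borel.
apply/seteqP; split => [_ [x Ax <-]|x Ax] /=; first by rewrite mulmxK.
by exists (x *m invmx M) => //; rewrite mulmxKV.
Qed.

Lemma hausdorff_bounded_lty (A : set 'rV[R]_n) (r : R) :
  (forall x, A x -> enorm x <= r) -> (hausdorff_measure n A < +oo)%E.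
Proof.
move=> Ar; pose N := (Num.truncn r).+1.
pose z (i : {ffun 'I_n -> 'I_(N + N)}) : {ffun 'I_n -> int} :=
  [ffun j => (i j : nat)%:Z - N%:Z].
apply: (@le_lt_trans _ _ (hausdorff_measure n
    (\bigcup_i (dyadic_cube 0 (z i) : set 'rV[R]_n)))); last first.
  apply: le_lt_trans (outer_measure_fintype _ _) _.
  by apply: lte_sum_pinfty => i _; exact: hausdorff_dyadic_cube_lty.
apply: le_outer_measure => x Ax.
have xN j : - N%:R <= x 0 j < N%:R.
  have := le_trans (le_coord_enorm x j) (Ar x Ax).
  move=> /le_lt_trans /(_ (truncnS_gt r)); rewrite ltr_norml => /andP[h1 h2].
  by rewrite h2 ltW.
have fx j : (0 <= Num.floor (x 0 j) + N%:Z < (N + N)%:Z).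
  have /andP[h1 h2] := xN j.
  rewrite -lerBlDr sub0r -ltrBrDr PoszD addrK.
  rewrite floor_ge_int floor_lt_int; rewrite mulrNz; exact/andP.
have i0 j : (absz (Num.floor (x 0%R j) + N%:Z)%R < N + N)%N.
  by rewrite -ltz_nat gez0_abs//; case/andP: (fx j).
exists [ffun j => Ordinal (i0 j)] => //; apply/ffunP => j.
by rewrite !ffunE expr0 mul1r /= gez0_abs ?addrK//; case/andP: (fx j).
Qed.

End BorelMaps.

Definition pushforward_measure d d' (T1 : measurableType d) (T2 : measurableType d')
    (R : realFieldType) (m : {measure set T1 -> \bar R}) (f : T1 -> T2)
    (mf : measurable_fun setT f) : {measure set T2 -> \bar R} :=
  measure_function_pushforward__canonical__measure_function_Measure m mf.

Lemma unit_cubeE (R : realType) (n : nat) :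
  dyadic_cube 0 [ffun=> 0] = [set x : 'rV[R]_n | forall j, 0 <= x 0 j < 1].
Proof.
rewrite dyadic_cubeE; apply/seteqP; split=> x /= h j; have := h j;
by rewrite ffunE expr0 !divr1 add0r.
Qed.

Section LinearScaling.
Context (R : realType) (n : nat).
Implicit Types (A : set (borel R n)) (M N : 'M[R]_n) (c : R).

Local Notation H := (@hausdorff_measure R n n).
Local Notation unit_cube := (dyadic_cube 0 [ffun=> 0] : set 'rV[R]_n).

Let H_cube_gt0 : (0 < H unit_cube)%E := hausdorff_unit_cube_gt0 R n.

Lemma unit_cube_fin_num : H unit_cube \is a fin_num.
Proof. by rewrite ge0_fin_numE ?(ltW H_cube_gt0)// hausdorff_dyadic_cube_lty. Qed.

(** Such a [c] is the absolute value of the determinant of [M]. *)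
Definition scales_hausdorff M c := forall A, measurable A ->
  (H [set x *m M | x in A] = c%:E * H A)%E.

Lemma scales_hausdorff_mul M N c d : M \in unitmx ->
  scales_hausdorff M c -> scales_hausdorff N d -> scales_hausdorff (M *m N) (c * d).
Proof.
move=> uM sM sN A mA.
rewrite (_ : [set _ | _ in _] = [set x *m N | x in [set x *m M | x in A]]); last first.
  apply/seteqP; split=> [_ [x Ax <-]|_ [_ [x Ax <-] <-]].
    by exists (x *m M); [exists x|rewrite mulmxA].
  by exists x => //; rewrite mulmxA.
by rewrite sN ?sM ?muleA ?EFinM 1?(muleC d%:E)//; exact: mulmx_image_borel.
Qed.

Lemma scales_hausdorff1 : scales_hausdorff 1%:M 1.
Proof.
move=> A mA; rewrite mul1e; congr H.
by rewrite (_ : (fun x => _) = id) ?image_id//; apply/funext => x; rewrite mulmx1.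
Qed.

Lemma scales_hausdorff_inj M c d :
  scales_hausdorff M c -> scales_hausdorff M d -> c = d.
Proof.
move=> /(_ _ (measurable_dyadic_cube 0 [ffun=> 0])) + /(_ _ (measurable_dyadic_cube 0 [ffun=> 0])).
move=> ->; rewrite -(fineK unit_cube_fin_num) -!EFinM => -[] /mulIf; apply.
by rewrite gt_eqF// fine_gt0// H_cube_gt0 -ge0_fin_numE ?unit_cube_fin_num ?(ltW H_cube_gt0).
Qed.

Lemma scales_hausdorff_ratio M : M \in unitmx ->
  scales_hausdorff M (fine (H [set x *m M | x in unit_cube]) / fine (H unit_cube)).
Proof.
move=> uM; set c := _ / _.
have QM_fin : H [set x *m M | x in unit_cube] \is a fin_num.
  rewrite ge0_fin_numE ?hausdorff_measure_ge0//.
  apply: (@hausdorff_bounded_lty _ _ _ (n%:R * (\sum_i \sum_j `|M i j|))).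
  move=> _ [x + <-]; rewrite unit_cubeE => x01.
  apply: enorm_le_coord => [|j]; first by apply: sumr_ge0 => i _; apply: sumr_ge0.
  rewrite mxE; apply: le_trans (ler_norm_sum _ _ _) _; apply: ler_sum => i _.
  rewrite normrM; apply: (@le_trans _ _ `|M i j|).
    have /andP[x0 x1] := x01 i.
    by rewrite ler_piMl// ger0_norm// ltW.
  by rewrite (bigD1 j)//= lerDl sumr_ge0.
have cE : (H [set x *m M | x in unit_cube] = c%:E * H unit_cube)%E.
  rewrite -[LHS](fineK QM_fin) -[in RHS](fineK unit_cube_fin_num) -EFinM /c divfK//.
  by rewrite gt_eqF// fine_gt0// H_cube_gt0 -ge0_fin_numE ?unit_cube_fin_num ?(ltW H_cube_gt0).
have c0 : 0 <= c by rewrite divr_ge0// fine_ge0// hausdorff_measure_ge0.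
have mf := mulmx_borel (invmx M).
(* Pushing forward along the inverse of [M] gives the measure A |-> H (A M), again
   translation-invariant. *)
pose m1 : {measure set (borel R n) -> \bar R} := pushforward_measure (borel_hausdorff n) mf.
pose m2 : {measure set (borel R n) -> \bar R} := mscale (NngNum c0) (borel_hausdorff n).
have m1E A : m1 A = H [set x *m M | x in A].
  rewrite /m1 /= /pushforward; congr H; apply/seteqP; split => [x Ax|_ [x Ax <-]] /=.
    by exists (x *m invmx M) => //; rewrite mulmxKV.
  by rewrite mulmxK.
suff : forall A, measurable A -> m1 A = m2 A by move=> e A mA; rewrite -m1E e.
apply: translation_invariant_unique.
- move=> v A mA; rewrite !m1E -[RHS](hausdorff_measure_translate n (v *m M)); congr H.
  apply/seteqP; split=> [_ [_ [x Ax <-] <-]|_ [_ [x Ax <-] <-]].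
    by exists (x *m M); [exists x|rewrite mulmxDl].
  by exists (x + v); [exists x|rewrite mulmxDl].
- move=> v A mA; rewrite /m2 /mscale/=; congr (_ * _)%E.
  exact: hausdorff_measure_translate.
- by rewrite m1E cE.
- by rewrite m1E -ge0_fin_numE// hausdorff_measure_ge0.
Qed.

End LinearScaling.

(** Cauchy's functional equation on the positive half-line. Nonnegativity makes [g] monotone;
    placing k a between consecutive integers then bounds the defect |g a - a g 1| by g 1 / k for
    every k > 0. *)
Lemma additive_nonneg_linear (R : realType) (g : R -> R) :
  (forall a b, 0 < a -> 0 < b -> g (a + b) = g a + g b) ->
  (forall a, 0 < a -> 0 <= g a) -> forall a, 0 < a -> g a = a * g 1.
Proof.
move=> gD g0 a a0.
have g_nat x k : 0 < x -> g (k.+1%:R * x) = k.+1%:R * g x.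
  move=> x0; elim: k => [|k ih]; first by rewrite !mul1r.
  by rewrite -[k.+2]addn1 natrD !mulrDl !mul1r gD ?ih// mulr_gt0.
have g_mono x y : 0 < x -> x < y -> g x <= g y.
  by move=> x0 xy; rewrite -(subrKC x y) gD ?lerDl ?g0// subr_gt0.
have g_near k : `|k.+1%:R * (g a - a * g 1)| <= g 1.
  have ka0 : 0 < k.+1%:R * a by rewrite mulr_gt0.
  have := g_nat 1 (Num.truncn (k.+1%:R * a)) ltr01; rewrite mulr1.
  have /andP[t1 t2] := truncn_itv (ltW ka0).
  set m := Num.truncn _ in t1 t2 * => gm.
  have up : k.+1%:R * g a <= m.+1%:R * g 1 by rewrite -g_nat// -gm g_mono.
  have lo : m%:R * g 1 <= k.+1%:R * g a.
    case: (m) t1 => [|p] t1; first by rewrite mul0r mulr_ge0// g0.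
    rewrite -!g_nat// mulr1.
    by move: t1; rewrite le_eqVlt => /predU1P[->//|/g_mono]; apply.
  have g10 : 0 <= g 1 by exact: g0.
  have := ler_wpM2r g10 t1; have := ler_wpM2r g10 (ltW t2).
  move: up; rewrite -[m.+1]addn1 natrD !mulrDl !mul1r => up u1 u2.
  by rewrite ler_norml; apply/andP; split; lra.
apply/eqP; rewrite -subr_eq0 -normr_le0 leNgt; apply/negP => d0.
have := g_near (Num.truncn (g 1 / `|g a - a * g 1|)).
rewrite normrM normr_nat -ler_pdivlMr// leNgt.
by rewrite truncnS_gt.
Qed.

Section DiagonalScaling.
Context (R : realType) (n : nat).
Implicit Types (A : set (borel R n)) (M N B T : 'M[R]_n) (d : 'rV[R]_n).

Local Notation H := (@hausdorff_measure R n n).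
Local Notation unit_cube := (dyadic_cube 0 [ffun=> 0] : set 'rV[R]_n).

Lemma diag_mx_unit d : (forall j, 0 < d 0 j) -> diag_mx d \in unitmx.
Proof.
by move=> d0; rewrite unitmxE det_diag unitfE; apply/prodf_neq0 => j _; rewrite gt_eqF.
Qed.

(** The box of side b + c in direction [j] is the disjoint union of the box of side b and a
    translate of the box of side c. Its measure is therefore additive in the side, hence linear. *)
Lemma scales_hausdorff_stretch (j : 'I_n) (a : R) : 0 < a ->
  scales_hausdorff (diag_mx (\row_k (if k == j then a else 1))) a.
Proof.
pose D (a : R) : 'rV[R]_n := \row_k (if k == j then a else 1).
have D0 b : 0 < b -> forall k, 0 < D b 0 k by move=> b0 k; rewrite mxE; case: ifP.
pose box b : set 'rV[R]_n := [set x *m diag_mx (D b) | x in unit_cube].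
have boxE b : 0 < b ->
    box b = [set x | forall k, 0 <= x 0 k < (if k == j then b else 1)].
  move=> b0; rewrite /box unit_cubeE; apply/seteqP; split=> [_ [x x01 <-] k|x xb].
    rewrite mul_mx_diag !mxE; have /andP[x0 x1] := x01 k.
    by case: ifP => _; rewrite ?mulr1 ?x0// mulr_ge0 ?(ltW b0)//= gtr_pMl.
  exists (\row_k (x 0 k / D b 0 k)).
    move=> k; have := xb k; rewrite !mxE; case: ifP => _; last by rewrite divr1.
    by rewrite ler_pdivlMr// mul0r ltr_pdivrMr// mul1r.
  by apply/rowP => k; rewrite mul_mx_diag !mxE divfK//; case: ifP => _ //; rewrite gt_eqF.
have mbox b : 0 < b -> measurable (box b : set (borel R n)).
  move=> b0; apply: mulmx_image_borel; first exact/diag_mx_unit/D0.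
  exact: measurable_dyadic_cube.
have fbox b : 0 < b -> H (box b) \is a fin_num.
  move=> b0; rewrite ge0_fin_numE ?hausdorff_measure_ge0//.
  apply: (@hausdorff_bounded_lty _ _ _ (n%:R * (b + 1))) => x; rewrite boxE// => xb.
  apply: enorm_le_coord; first by rewrite addr_ge0// ltW.
  move=> k; have /andP[x0 x1] := xb k; rewrite ger0_norm//.
  by move: x1; case: ifP => _ /ltW /le_trans; apply; rewrite ?lerDl// lerDr ltW.
have gD b c : 0 < b -> 0 < c -> fine (H (box (b + c))) = fine (H (box b)) + fine (H (box c)).
  move=> b0 c0; have bc0 := addr_gt0 b0 c0.
  pose v : 'rV[R]_n := \row_k (if k == j then b else 0).
  have boxD : box (b + c) = box b `|` [set x + v | x in box c].
    rewrite !boxE//; apply/seteqP; split=> x.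
      move=> xb; have [xjb|bxj] := ltP (x 0 j) b; [left|right].
        by move=> k; have := xb k; case: ifP => // /eqP -> /andP[-> _].
      exists (x - v); last by rewrite subrK.
      move=> k; have := xb k; rewrite !mxE; case: ifP => [/eqP ->|_]; last by rewrite subr0.
      by rewrite subr_ge0 bxj ltrBlDl => /andP[].
    case=> [xb k|[y yc <-] k]; [have := xb k|have := yc k; rewrite !mxE].
      by case: ifP => // _ /andP[-> /lt_le_trans]; apply; rewrite lerDl ltW.
    case: ifP => _; last by rewrite addr0.
    by move=> /andP[y0 y1]; rewrite addr_ge0 ?(ltW b0)//= addrC ltrD2l.
  have mv : measurable ([set x + v | x in box c] : set (borel R n)).
    rewrite (_ : [set _ | _ in _] = box (b + c) `\` box b); first by apply: measurableD; exact: mbox.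
    rewrite boxD setDUl setDv set0U; apply/esym/setDidPl; apply/seteqP; split => // x.
    rewrite !boxE// => -[[y yc <-] /(_ j)]; have := yc j; rewrite !mxE eqxx.
    by move=> /andP[y0 _] /andP[_]; rewrite gtrDr ltNge y0.
  rewrite -fineD ?fbox//; congr fine.
  rewrite -(hausdorff_measure_translate n v (box c)) boxD.
  apply: (@measureU _ _ _ (borel_hausdorff n)) => //; first exact: mbox.
  apply/seteqP; split => // x.
  rewrite !boxE// => -[/(_ j) + [y yc yx]]; rewrite -yx; have := yc j; rewrite !mxE eqxx.
  by move=> /andP[y0 _] /andP[_]; rewrite gtrDr ltNge y0.
move=> a0; have := scales_hausdorff_ratio (diag_mx_unit (D0 a a0)).
have box1 : box 1 = unit_cube.
  by rewrite boxE// unit_cubeE; apply/seteqP; split=> x /= xb k; have := xb k; case: ifP.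
rewrite -/(box a) (additive_nonneg_linear gD _ a0) ?box1.
  rewrite mulfK// gt_eqF// fine_gt0// -ge0_fin_numE ?hausdorff_measure_ge0//.
  by rewrite unit_cube_fin_num hausdorff_unit_cube_gt0.
by move=> b b0; rewrite fine_ge0// hausdorff_measure_ge0.
Qed.

Lemma scales_hausdorff_diag d : (forall j, 0 < d 0 j) ->
  scales_hausdorff (diag_mx d) (\prod_j d 0 j).
Proof.
move=> d0.
pose E (s : seq 'I_n) : 'rV[R]_n := \row_k (if k \in s then d 0 k else 1).
suff main s : uniq s -> scales_hausdorff (diag_mx (E s)) (\prod_(j <- s) d 0 j).
  have := main (index_enum _) (index_enum_uniq _).
  rewrite (_ : E _ = d)//; apply/rowP => k; rewrite mxE mem_index_enum //.
elim: s => [_|j s ih /= /andP[js us]].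
  rewrite big_nil (_ : diag_mx _ = 1%:M); first exact: scales_hausdorff1.
  by rewrite -diag_const_mx; congr diag_mx; apply/rowP => k; rewrite !mxE.
rewrite big_cons.
rewrite (_ : diag_mx _ = diag_mx (\row_k (if k == j then d 0 j else 1)) *m diag_mx (E s)).
  apply: scales_hausdorff_mul; last exact: ih; last exact: scales_hausdorff_stretch.
  by apply: diag_mx_unit => k; rewrite mxE; case: ifP.
rewrite mulmx_diag; congr diag_mx; apply/rowP => k; rewrite !mxE in_cons.
by case: eqP => [->|_] /=; rewrite ?(negbTE js) ?mulr1 ?mul1r.
Qed.

(** [T] is conjugate to the diagonal matrix, and the factors of [B] and of its inverse multiply to
    1. *)
Lemma scales_hausdorff_conj B T d : B \in unitmx -> (forall j, 0 < d 0 j) ->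
  B *m T = diag_mx d *m B -> scales_hausdorff T (\prod_j d 0 j).
Proof.
move=> uB d0 BT; have uB' : invmx B \in unitmx by rewrite unitmx_inv.
have ud := diag_mx_unit d0.
have -> : T = invmx B *m diag_mx d *m B by rewrite -mulmxA -BT mulKmx.
have s1 := scales_hausdorff_ratio uB'; have s2 := scales_hausdorff_ratio uB.
move: (_ / _) s1 (_ / _) s2 => c s1 c' s2.
have cc' : c * c' = 1.
  have s12 := scales_hausdorff_mul uB' s1 s2; rewrite mulVmx// in s12.
  exact: scales_hausdorff_inj s12 (@scales_hausdorff1 _ _).
have := scales_hausdorff_mul _ (scales_hausdorff_mul uB' s1 (scales_hausdorff_diag d0)) s2.
by rewrite mulrAC cc' mul1r; apply; rewrite unitmx_mul uB' ud.
Qed.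

End DiagonalScaling.

(** * Metric projection *)

Section MetricProjection.
Context (R : realType) (n : nat) (K : set 'rV[R]_n).
Hypothesis convK : convex_body K.
Implicit Types (x y z p : 'rV[R]_n) (t r : R).

Local Notation pK := (metric_proj K).

Lemma convex_body_comb x y t : K x -> K y -> 0 <= t <= 1 ->
  K (t *: x + (1 - t) *: y).
Proof.
case: convK => _ _ cK Kx Ky /andP[t0 t1].
by have := cK x y (Itv01 t0 t1) (mem_set Kx) (mem_set Ky); rewrite inE.
Qed.

Lemma convex_body_closed : closed K.
Proof. by case: convK => _ cK _; apply: compact_closed => //; exact: norm_hausdorff. Qed.

Lemma enorm_continuous x : continuous (fun y => enorm (x - y) : R^o).
Proof.
apply: (@lipschitz_continuous _ _ R^o _ 1) => y z; rewrite mul1r ler_norml.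
have := enorm_triangle y x z; have := enorm_triangle z x y.
rewrite (enorm_distC z y) => h1 h2; apply/andP; split; lra.
Qed.

Lemma metric_proj_spec x : K (pK x) /\ forall y, K y -> enorm (x - pK x) <= enorm (x - y).
Proof.
case: (convK) => K0 cK _.
have [p /set_mem Kp pmin] := EVT_min_rV K0 cK (continuous_subspaceT (@enorm_continuous x)).
have h : exists p, K p /\ forall y, K y -> enorm (x - p) <= enorm (x - y).
  by exists p; split => // y Ky; apply: pmin; exact: mem_set.
exact: (xgetPex 0 h).
Qed.

Lemma metric_proj_in x : K (pK x). Proof. exact: (metric_proj_spec x).1. Qed.

Lemma metric_proj_dot_le0 x y : K y -> dot (x - pK x) (y - pK x) <= 0.
Proof.
move=> Ky; have [Kp pmin] := metric_proj_spec x; set p := pK x in Kp pmin *.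
rewrite leNgt; apply/negP => d0.
have yp : 0 < dot (y - p) (y - p).
  rewrite lt_def dot_ge0 dot_eq0 andbT; apply/eqP => yp.
  by move: d0; rewrite yp dotC dot0l ltxx.
(* The parameter in [0, 1] at which the segment from [p] to [y] comes nearest to [x]. *)
pose t := Num.min 1 (dot (x - p) (y - p) / dot (y - p) (y - p)).
have t0 : 0 < t by rewrite lt_min ltr01 divr_gt0.
have t1 : t <= 1 by rewrite ge_min lexx.
have := pmin _ (convex_body_comb Ky Kp (_ : 0 <= t <= 1)).
rewrite (ltW t0) t1 => /(_ isT).
have -> : x - (t *: y + (1 - t) *: p) = (x - p) - t *: (y - p).
  by rewrite scalerBl scalerBr scale1r opprD opprB opprB addrACA [RHS]addrAC;
     apply/rowP => i; rewrite !mxE; ring.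
rewrite -(@ler_pXn2r _ 2%N) ?nnegrE ?enorm_ge0// !enorm_sqr.
rewrite (dotBl (x - p)) !(dotBr _ (x - p)) !dotZl !dotZr (dotC (y - p) (x - p)).
set a := dot (x - p) (y - p) in d0 t t0 t1 *; set b := dot (y - p) (y - p) in yp t t0 t1 *.
have tb : t * b <= a by rewrite -ler_pdivlMr// ge_min lexx orbT.
have := ler_wpM2l (ltW t0) tb; have := mulr_gt0 t0 d0.
by move=> h1 h2 h3; move: h1 h2 h3; lra.
Qed.

Lemma metric_proj_eq x p : K p -> (forall y, K y -> dot (x - p) (y - p) <= 0) ->
  pK x = p.
Proof.
move=> Kp h; have := h _ (metric_proj_in x); have := metric_proj_dot_le0 x Kp.
move=> h1 h2; apply/eqP; rewrite -subr_eq0 -dot_eq0 eq_le dot_ge0 andbT.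
move: h1 h2; set q := pK x; by rewrite !(dotBl, dotBr) (dotC p q); lra.
Qed.

Lemma metric_proj_id x : K x -> pK x = x.
Proof. by move=> Kx; apply: metric_proj_eq => // y _; rewrite subrr dot0l. Qed.

Lemma metric_proj_lipschitz x y : enorm (pK x - pK y) <= enorm (x - y).
Proof.
have := metric_proj_dot_le0 x (metric_proj_in y).
have := metric_proj_dot_le0 y (metric_proj_in x).
set p := pK x; set q := pK y => h1 h2.
have : dot (p - q) (p - q) <= dot (x - y) (p - q).
  by move: h1 h2; rewrite !(dotBl, dotBr) (dotC p q); lra.
move=> /le_trans /(_ (dot_le_enorm _ _)); rewrite -enorm_sqr expr2.
have [->|pq] := eqVneq (enorm (p - q)) 0; first by rewrite enorm_ge0.
by rewrite ler_pM2r// lt_def pq enorm_ge0.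
Qed.

Lemma metric_proj_continuous : continuous pK.
Proof.
apply: (@lipschitz_continuous _ _ _ _ 1) => x y; rewrite mul1r.
exact: le_trans (norm_le_enorm _) (metric_proj_lipschitz x y).
Qed.

Lemma dist_to_gt0 x : (0 < dist_to K x) = (x \notin K).
Proof.
rewrite /dist_to lt_def enorm_ge0 andbT enorm_eq0 subr_eq0; congr (~~ _).
apply/eqP/idP => [->|/set_mem /metric_proj_id //].
by rewrite inE; exact: metric_proj_in.
Qed.

Lemma dist_to_continuous : continuous (dist_to K : _ -> R^o).
Proof.
(* The constant 2 is one for the identity and one for the projection. *)
apply: (@lipschitz_continuous _ _ R^o _ 2) => x y; rewrite /dist_to.
have := enormD (y - pK y) ((x - y) - (pK x - pK y)).
have := enormD (x - pK x) ((y - x) - (pK y - pK x)).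
have := metric_proj_lipschitz x y.
have := enormD (x - y) (- (pK x - pK y)).
have := enormD (y - x) (- (pK y - pK x)).
rewrite !enormN (enorm_distC y x) (enorm_distC (pK y)).
have -> : x - pK x + (y - x - (pK y - pK x)) = y - pK y.
  by apply/rowP => i; rewrite !mxE; ring.
have -> : y - pK y + (x - y - (pK x - pK y)) = x - pK x.
  by apply/rowP => i; rewrite !mxE; ring.
move: (enorm (x - pK x)) (enorm (y - pK y)) (enorm (x - y)) (enorm (pK x - pK y)).
move: (enorm (x - y - _)) (enorm (y - x - _)) => e f a b c d h1 h2 h3 h4 h5.
by rewrite ler_norml; apply/andP; split; lra.
Qed.

Lemma parallel_bodyE r : 0 < r -> parallel_body K r = [set x | dist_to K x <= r].
Proof.
move=> r0; apply/seteqP; split=> [_ [y Ky [b b1 <-]]|x xr] /=.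
  apply: le_trans ((metric_proj_spec _).2 _ Ky) _.
  move: b1; rewrite /eball/= subr0 (addrC y) addrK enormZ gtr0_norm// => b1.
  by rewrite -[leRHS]mulr1 ler_wpM2l// ltW.
exists (pK x); first exact: metric_proj_in.
exists (r^-1 *: (x - pK x)); last by rewrite scalerA divff ?gt_eqF// scale1r subrKC.
by rewrite /eball/= subr0 enormZ gtr0_norm ?invr_gt0// mulrC ler_pdivrMr// mul1r.
Qed.

Definition normal_stretch r x := pK x + r *: (x - pK x).

Let stretchB r x : normal_stretch r x - pK x = r *: (x - pK x).
Proof. by rewrite /normal_stretch addrAC subrr add0r. Qed.

Lemma metric_proj_stretch r x : 0 <= r -> pK (normal_stretch r x) = pK x.
Proof.
move=> r0; apply: metric_proj_eq; first exact: metric_proj_in.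
move=> y Ky; rewrite stretchB dotZl.
by rewrite mulr_ge0_le0// metric_proj_dot_le0.
Qed.

Lemma dist_to_stretch r x : 0 <= r -> dist_to K (normal_stretch r x) = r * dist_to K x.
Proof.
move=> r0; rewrite /dist_to metric_proj_stretch// stretchB.
by rewrite enormZ ger0_norm.
Qed.

Lemma unit_normal_stretch r x : 0 < r ->
  unit_normal K (normal_stretch r x) = unit_normal K x.
Proof.
move=> r0; rewrite /unit_normal dist_to_stretch ?ltW// metric_proj_stretch ?ltW//.
by rewrite stretchB scalerA invfM mulrAC mulVf ?mul1r// gt_eqF.
Qed.

Lemma normal_stretchK r x : 0 < r ->
  normal_stretch r^-1 (normal_stretch r x) = x.
Proof.
move=> r0; rewrite {1}/normal_stretch metric_proj_stretch ?ltW//.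
by rewrite stretchB scalerA mulVf ?gt_eqF// scale1r subrKC.
Qed.

Lemma normal_stretch_out r x : 0 < r -> ~ K x -> ~ K (normal_stretch r x).
Proof.
move=> r0 Kx; have : 0 < dist_to K (normal_stretch r x).
  by rewrite dist_to_stretch ?ltW// mulr_gt0// dist_to_gt0; apply/negP; rewrite inE.
by rewrite dist_to_gt0 => /negP + Kr; apply; rewrite inE.
Qed.

Lemma enorm_unit_normal x : ~ K x -> enorm (unit_normal K x) = 1.
Proof.
move=> Kx; have d0 : 0 < dist_to K x by rewrite dist_to_gt0; apply/negP; rewrite inE.
by rewrite /unit_normal enormZ gtr0_norm ?invr_gt0// mulVf// gt_eqF.
Qed.

End MetricProjection.

(** * The constants kappa and the normal map *)

Section Kappa.
Context (R : realType).
Local Open Scope ereal_scope.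

Lemma hausdorff_dyadic_cube_gt0 n k :
  0 < hausdorff_measure n (dyadic_cube k [ffun=> 0%R] : set 'rV[R]_n).
Proof.
elim: k => [|k ih]; first exact: hausdorff_unit_cube_gt0.
have T : translation_invariant (@borel_hausdorff R n n).
  by move=> v A _; exact: hausdorff_measure_translate.
rewrite lt_def hausdorff_measure_ge0 andbT; apply/eqP => h0.
have e : hausdorff_measure n (dyadic_cube k [ffun=> 0%R] : set 'rV[R]_n) =
    (2 ^ n)%:R%:E * hausdorff_measure n (dyadic_cube k.+1 [ffun=> 0%R] : set 'rV[R]_n).
  exact: (@translation_invariant_cube_succ R n (borel_hausdorff n) k T).
by move: ih; rewrite e h0 mule0 ltxx.
Qed.

Lemma kappa_gt0 j : 0 < kappa R j.
Proof.
have [k jk] : exists k, (j%:R / 2 ^+ k <= 1 :> R)%R.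
  exists j; rewrite ler_pdivrMr ?exprn_gt0// mul1r -natrX ler_nat.
  exact/ltnW/ltn_expl.
apply: (lt_le_trans (hausdorff_dyadic_cube_gt0 j k)).
apply: le_outer_measure => x; rewrite dyadic_cubeE => xk.
rewrite /eball/= subr0; apply: le_trans jk; apply: enorm_le_coord.
  by rewrite invr_ge0 exprn_ge0.
move=> i; have /andP := xk i; rewrite ffunE add0r mul0r mul1r => -[x0 x1].
by rewrite ger0_norm// ltW.
Qed.

Lemma kappa_fin_num j : kappa R j \is a fin_num.
Proof.
rewrite ge0_fin_numE ?(ltW (kappa_gt0 j))//.
apply: (@hausdorff_bounded_lty _ _ _ 1) => x.
by rewrite /eball/= subr0.
Qed.

End Kappa.

Section NormalPoint.
Context (R : realType) (n : nat) (K : set 'rV[R]_n.+1).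
Hypothesis convK : convex_body K.
Implicit Types (x : 'rV[R]_n.+1) (r : R) (eta : set (borel_Sigma R n.+1)).

(** A total version of x |-> (p_K(x), u_K(x)). On K the vector [unit_normal] is 0, not a unit
    vector, and the default [point] is taken. With it local parallel sets become preimages under a
    Borel map, and support measures can be built as pushforwards. *)
Definition normal_pt x : borel_Sigma R n.+1 :=
  if (insub (metric_proj K x, unit_normal K x) : option (set_type (Sigma_set R n.+1)))
  is Some a then a else point.

Lemma val_normal_pt x : ~ K x ->
  val (normal_pt x : set_type (Sigma_set R n.+1)) = (metric_proj K x, unit_normal K x).
Proof.
move=> Kx; rewrite /normal_pt; case: insubP => [a _ -> //|/negP[]].
by apply: mem_set; rewrite /Sigma_set/= enorm_unit_normal.
Qed.

Lemma normal_pt_in x : K x -> normal_pt x = point.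
Proof.
move=> Kx; rewrite /normal_pt; case: insubP => // a /set_mem; rewrite /Sigma_set/=.
rewrite /unit_normal (metric_proj_id convK Kx) subrr scaler0 enorm0.
by move=> /eqP; rewrite eq_sym oner_eq0.
Qed.

Definition outer_shell r : set 'rV[R]_n.+1 := [set x | ~ K x /\ dist_to K x <= r].

Lemma local_parallel_volumeE r eta : 0 < r ->
  local_parallel_volume K r eta =
  hausdorff_measure n.+1 (outer_shell r `&` normal_pt @^-1` eta).
Proof.
move=> r0; rewrite /local_parallel_volume (parallel_bodyE convK r0); congr hausdorff_measure.
apply/seteqP; split=> x.
  move=> [[xr Kx] [a ea e]]; split => //=.
  rewrite (_ : normal_pt x = a)//; apply: val_inj; rewrite val_normal_pt//.
move=> [[Kx xr] /= ex]; split => //; exists (normal_pt x) => //.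
exact: val_normal_pt.
Qed.

Lemma measurable_outer_shell r : measurable (outer_shell r : set (borel R n.+1)).
Proof.
apply: measurableI.
  by apply: open_borel; apply: closed_openC; exact: convex_body_closed.
apply: closed_borel; apply: (@preimage_closed _ _ (dist_to K) [set y | y <= r]).
  by move=> x _; exact: dist_to_continuous.
exact: closed_le.
Qed.

Lemma measurable_normal_pt : measurable_fun setT (normal_pt : borel R n.+1 -> _).
Proof.
apply: measurability => // _ [U oU <-]; rewrite setTI.
have mK : measurable (K : set (borel R n.+1)).
  by apply: closed_borel; exact: convex_body_closed.
have KC : open (~` K) by apply: closed_openC; exact: convex_body_closed.
(* The map is constant on the closed set K and continuous on its open complement. *)
rewrite -[X in measurable X](setIT) -(setUv K) setIUr; apply: measurableU.
  have [Up|Up] := pselect (U point).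
    rewrite (_ : _ `&` _ = K)//; apply/seteqP; split=> [x [] //|x Kx].
    by split; rewrite //= normal_pt_in.
  rewrite (_ : _ `&` _ = set0)//; apply/seteqP; split=> [x [] + Kx|//].
  by rewrite /= normal_pt_in.
apply: open_borel; case: oU => V oV VU; rewrite openE => x [xU Kx].
have dx : dist_to K x != 0.
  by rewrite gt_eqF// (dist_to_gt0 convK); apply/negP; rewrite inE.
have cu : unit_normal K y @[y --> x] --> unit_normal K x.
  have c1 : (dist_to K y)^-1 @[y --> x] --> (dist_to K x)^-1.
    exact: (@cvgV R _ (nbhs x) (nbhs_filter x) (dist_to K) _ dx (@dist_to_continuous _ _ _ convK x)).
  have c2 : y - metric_proj K y @[y --> x] --> x - metric_proj K x.
    exact: (@cvgB _ _ _ (nbhs x) (nbhs_filter x) id (metric_proj K) x _ cvg_id (@metric_proj_continuous _ _ _ convK x)).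
  exact: (@cvgZ _ _ _ (nbhs x) (nbhs_filter x) _ _ _ _ c1 c2).
have Vx : V (metric_proj K x, unit_normal K x).
  by move: xU; rewrite -VU /= => Vx; rewrite -val_normal_pt.
have [[V1 V2] [/= n1 n2] V12] := open_nbhs_nbhs (conj oV Vx).
have h0 : nbhs x (~` K) := open_nbhs_nbhs (conj KC Kx).
have h1 : nbhs x (metric_proj K @^-1` V1) := @metric_proj_continuous _ _ _ convK x _ n1.
have h2 : nbhs x (unit_normal K @^-1` V2) := cu _ n2.
have F := nbhs_filter x.
apply: (@filterS _ (nbhs x) F _ _ _ (@filterI _ _ F _ _ (@filterI _ _ F _ _ h0 h1) h2)).
move=> y [[Ky V1y] V2y]; split; last exact: Ky.
suff : U (normal_pt y) by [].
rewrite -VU; suff : V (val (normal_pt y : set_type (Sigma_set R n.+1))) by [].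
rewrite val_normal_pt//; apply: (V12 (metric_proj K y, unit_normal K y)).
exact: (conj V1y V2y).
Qed.

Lemma measurable_preimage_normal_pt eta : measurable eta ->
  measurable (normal_pt @^-1` eta : set (borel R n.+1)).
Proof. by move=> me; rewrite -[X in measurable X]setTI; exact: measurable_normal_pt. Qed.

End NormalPoint.

(** * The local Steiner formula for polyhedra *)

Section OrthogonalStretch.
Context (R : realType).

Lemma dot_rowspace_ker m q (U : 'M[R]_(q, m)) (u v : 'rV[R]_m) :
  (u <= U)%MS -> v *m U^T = 0 -> dot v u = 0.
Proof.
by move=> /submxP[w ->] vU; rewrite dotE trmx_mul mulmxA vU mul0mx mxE.
Qed.

Section Complement.
Context (m q : nat) (U : 'M[R]_(q, m)).
(** The orthogonal complement of the row space of [U]. *)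
Let V := kermx U^T.

Let capUV : (U :&: V = 0)%MS.
Proof.
apply/eqP; rewrite -submx0; apply/rV_subP => w; rewrite sub_capmx => /andP[wU wV].
have /eqP := dot_rowspace_ker wU (sub_kermxP wV).
by rewrite dot_eq0 => /eqP ->; exact: sub0mx.
Qed.

Let rankUV : (\rank U + \rank V)%N = m.
Proof. by rewrite mxrank_ker mxrank_tr subnKC// rank_leq_col. Qed.

Lemma rowspace_of_orthogonal (y : 'rV[R]_m) :
  (forall v, v *m U^T = 0 -> dot y v = 0) -> (y <= U)%MS.
Proof.
move=> yV; have : (y <= U + V)%MS.
  apply: submx_full; rewrite /row_full (mxrank_disjoint_sum capUV).
  by rewrite rankUV.
move=> /sub_addsmxP[[a b] /= yE].
have bV : b *m V *m U^T = 0 by rewrite -mulmxA mulmx_ker mulmx0.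
have /eqP := yV _ bV; rewrite {1}yE dotDl dotC (dot_rowspace_ker (submxMl a U) bV) add0r.
by rewrite dot_eq0 => /eqP b0; rewrite yE b0 addr0 submxMl.
Qed.

Lemma orthogonal_stretch (r : R) : 0 < r ->
  exists T : 'M[R]_m, [/\ scales_hausdorff T (r ^+ \rank U),
    forall w : 'rV_m, (w <= U)%MS -> w *m T = r *: w &
    forall w : 'rV_m, w *m U^T = 0 -> w *m T = w].
Proof.
move=> r0.
(* With [k] and [l] as variables, m can be replaced by k + l, which makes the stacked bases of the
   two spaces a square matrix. *)
suff main k l (B1 : 'M[R]_(k, m)) (B2 : 'M[R]_(l, m)) : (k + l)%N = m ->
    row_free (col_mx B1 B2) ->
    exists T : 'M[R]_m, [/\ scales_hausdorff T (r ^+ k), B1 *m T = r *: B1 & B2 *m T = B2].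
  have [|T [sT UT VT]] := main _ _ (row_base U) (row_base V) rankUV.
    rewrite /row_free -addsmxE (adds_eqmx (eq_row_base U) (eq_row_base V)).
    by rewrite (mxrank_disjoint_sum capUV).
  exists T; split => // w.
    move=> wU; have /submxP[a ->] : (w <= row_base U)%MS by rewrite eq_row_base.
    by rewrite -mulmxA UT [RHS]scalemxAr.
  move=> /sub_kermxP wV; have /submxP[a ->] : (w <= row_base V)%MS by rewrite eq_row_base.
  by rewrite -mulmxA VT.
move=> klm; case: _ / klm B1 B2 => B1 B2 freeB.
pose B : 'M[R]_(k + l) := col_mx B1 B2.
have uB : B \in unitmx by rewrite -row_free_unit.
pose d : 'rV[R]_(k + l) := row_mx (const_mx r) (const_mx 1).
have d0 j : 0 < d 0 j.
  by rewrite /d mxE; case: splitP => i _; rewrite mxE.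
have dB : B *m (invmx B *m diag_mx d *m B) = diag_mx d *m B.
  by rewrite !mulmxA mulmxV// mul1mx.
exists (invmx B *m diag_mx d *m B).
have e : diag_mx d *m B = col_mx (r *: B1) B2.
  by rewrite /B diag_mx_row mul_block_col !diag_const_mx !mul0mx addr0 add0r mul_scalar_mx mul1mx.
move: (dB); rewrite e /B mul_col_mx => /eq_col_mx[e1 e2]; split => //.
have -> : r ^+ k = \prod_j d 0 j.
  rewrite big_split_ord /= (eq_bigr (fun=> r)) => [|i _]; last by rewrite row_mxEl mxE.
  rewrite [X in _ * X]big1 => [|i _]; last by rewrite row_mxEr mxE.
  by rewrite mulr1 prodr_const card_ord.
exact: scales_hausdorff_conj uB d0 dB.
Qed.

End Complement.
End OrthogonalStretch.

Section PolyhedronSteiner.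
Context (R : realType) (n : nat) (J : finType) (a : J -> 'rV[R]_n.+1) (b : J -> R).
Implicit Types (x p d : 'rV[R]_n.+1) (A : {set J}) (r : R).

Definition polyhedron : set 'rV[R]_n.+1 := [set x | forall j, dot (a j) x <= b j].

Definition active p : {set J} := finset (fun j => dot (a j) p == b j).

(** Zero rows stand for the constraints outside [A], so that the size does not depend on [A]. *)
Definition constraint_mx A : 'M[R]_(#|J|, n.+1) :=
  \matrix_k (if enum_val k \in A then a (enum_val k) else 0).

Lemma constraint_mx_orthP A d :
  d *m (constraint_mx A)^T = 0 <-> forall j, j \in A -> dot (a j) d = 0.
Proof.
have E k : (d *m (constraint_mx A)^T) 0 k =
    if enum_val k \in A then dot (a (enum_val k)) d else 0.
  transitivity (dot (row k (constraint_mx A)) d).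
    by rewrite mxE; apply: eq_bigr => l _; rewrite !mxE mulrC.
  by rewrite rowK; case: ifP => // _; rewrite dot0l.
split=> [dA j jA|dA].
  have := congr1 (fun w : 'rV_ _ => w 0 (enum_rank j)) dA.
  by rewrite E enum_rankK jA mxE.
by apply/rowP => k; rewrite E mxE; case: ifP => // /dA.
Qed.

Local Notation K := polyhedron.
Hypothesis convK : convex_body K.
Local Notation pK := (metric_proj K).

(** A short move from p_K(x) along [d] or -[d] stays in K: active constraints do not change, the
    others have slack. The variational inequality in both directions gives equality. *)
Lemma active_orthogonal x d :
  (forall j, j \in active (pK x) -> dot (a j) d = 0) -> dot (x - pK x) d = 0.
Proof.
move=> dact; set p := pK x in dact *.
have Kp : K p := metric_proj_in convK x.
pose s j := (b j - dot (a j) p) / (1 + `|dot (a j) d|).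
have den j : 0 < 1 + `|dot (a j) d| by rewrite ltr_pwDl.
(* The length that the slack of every inactive constraint allows; the 1 added in the denominators
   avoids division by zero, and the initial value 1 covers the case without inactive constraints. *)
pose e : R := \big[Num.min/1]_(j | j \notin active p) s j.
have e0 : 0 < e.
  apply: lt_bigmin => // j; rewrite inE => jp.
  by rewrite divr_gt0// subr_gt0 lt_neqAle jp Kp.
have Kpm c : `|c| <= e -> K (p + c *: d).
  move=> ce j; rewrite dotDr dotZr.
  have [/dact ->|jp] := boolP (j \in active p); first by rewrite mulr0 addr0 Kp.
  rewrite -lerBrDl; apply: le_trans (ler_norm _) _; rewrite normrM.
  have es : e <= s j by exact: bigmin_le_cond.
  have := le_trans ce es; rewrite ler_pdivlMr// mulrDr mulr1.
  by apply: le_trans; rewrite lerDr.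
have ee : `|e| <= e by rewrite ger0_norm// ltW.
have ne : `|- e| <= e by rewrite normrN.
have := metric_proj_dot_le0 convK x (Kpm e ee).
have := metric_proj_dot_le0 convK x (Kpm (- e) ne).
rewrite -/p ![p + _ - p]addrAC subrr !add0r !dotZr mulNr oppr_le0.
rewrite pmulr_rge0// pmulr_rle0// => h1 h2.
by apply/eqP; rewrite eq_le h1 h2.
Qed.

Lemma normal_in_rowspace x : (x - pK x <= constraint_mx (active (pK x)))%MS.
Proof.
apply: rowspace_of_orthogonal => v /constraint_mx_orthP.
exact: active_orthogonal.
Qed.

Definition shell_part r A (eta : set (borel_Sigma R n.+1)) : set 'rV[R]_n.+1 :=
  outer_shell K r `&` normal_pt K @^-1` eta `&` [set x | active (pK x) = A].

Lemma measurable_active (P : pred {set J}) :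
  measurable ([set x | P (active (pK x))] : set (borel R n.+1)).
Proof.
rewrite (_ : mkset _ = \bigcup_A (if P A then [set x | active (pK x) = A] else set0)).
  apply: fin_bigcup_measurable; first exact: finite_finset.
  move=> A _; case: ifP => // _.
  rewrite (_ : mkset _ = \bigcap_j (if j \in A then [set x | dot (a j) (pK x) = b j]
      else ~` [set x | dot (a j) (pK x) = b j])).
    have cl j : measurable ([set x | dot (a j) (pK x) = b j] : set (borel R n.+1)).
      apply: closed_borel.
      apply: (@preimage_closed _ _ (dot (a j) \o pK) [set b j]); last exact: closed_eq.
      move=> x _; apply: continuous_comp; first exact: metric_proj_continuous.
      exact: dot_continuous.
    apply: fin_bigcap_measurable; first exact: finite_finset.
    by move=> j _; case: ifP => // _; exact: measurableC.
  apply/seteqP; split=> x /= => [<- j _|h].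
    by case: ifP; rewrite inE => /eqP.
  apply/setP => j; rewrite inE; have := h j I.
  by case: ifP => _ /=; [move=> ->; rewrite eqxx|move=> /eqP /negbTE].
apply/seteqP; split=> x /=.
  by move=> Px; exists (active (pK x)) => //; rewrite Px.
by move=> [A _]; case: ifP => // PA /= ->.
Qed.

Lemma measurable_shell_part r A eta : measurable eta ->
  measurable (shell_part r A eta : set (borel R n.+1)).
Proof.
move=> me; apply: measurableI; last first.
  rewrite (_ : mkset _ = [set x | pred1 A (active (pK x))]).
    exact: measurable_active.
  by apply/seteqP; split=> x /= /eqP.
apply: measurableI; first exact: measurable_outer_shell.
exact: measurable_preimage_normal_pt.
Qed.

Lemma shell_part_stretch r A eta x : 0 < r ->
  shell_part 1 A eta x -> shell_part r A eta (normal_stretch K r x).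
Proof.
move=> r0 [[[Kx x1] /= ex] xA]; split; last by rewrite /= metric_proj_stretch// ltW.
split.
  split; first exact: (normal_stretch_out convK r0).
  by rewrite /= (dist_to_stretch convK _ (ltW r0)) ler_piMr// ltW.
suff e : normal_pt K (normal_stretch K r x) = normal_pt K x by rewrite /= e.
by rewrite /normal_pt unit_normal_stretch// metric_proj_stretch// ltW.
Qed.

Lemma shell_part_unstretch r A eta x : 0 < r ->
  shell_part r A eta x -> shell_part 1 A eta (normal_stretch K r^-1 x).
Proof.
move=> r0 [[[Kx xr] /= ex] xA]; have r0' : 0 < r^-1 by rewrite invr_gt0.
split; last by rewrite /= metric_proj_stretch// ltW.
split.
  split; first exact: (normal_stretch_out convK r0').
  by rewrite /= (dist_to_stretch convK _ (ltW r0')) mulrC ler_pdivrMr// mul1r.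
suff e : normal_pt K (normal_stretch K r^-1 x) = normal_pt K x by rewrite /= e.
by rewrite /normal_pt unit_normal_stretch// metric_proj_stretch// ltW.
Qed.

(* On a cell the stretching map along normals is affine: it fixes the linear
   space orthogonal to the active constraints and scales its complement. *)
Lemma hausdorff_shell_part r A eta : 0 < r -> measurable eta ->
  (hausdorff_measure n.+1 (shell_part r A eta) =
   (r ^+ \rank (constraint_mx A))%:E * hausdorff_measure n.+1 (shell_part 1 A eta))%E.
Proof.
move=> r0 me.
have [[x0 x0P]|no] := pselect (exists x0, shell_part 1 A eta x0); last first.
  have -> : shell_part 1 A eta = set0.
    by apply/seteqP; split => // x xP; apply: no; exists x.
  have -> : shell_part r A eta = set0.
    apply/seteqP; split => // x xP; apply: no; exists (normal_stretch K r^-1 x).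
    exact: shell_part_unstretch.
  by rewrite hausdorff_measure0 mule0.
have [T [sT UT VT]] := orthogonal_stretch (constraint_mx A) r0.
rewrite -sT; last exact: measurable_shell_part.
rewrite -[RHS](hausdorff_measure_translate n.+1 (normal_stretch K r x0 - x0 *m T)).
congr hausdorff_measure.
have E x : shell_part 1 A eta x ->
    x *m T + (normal_stretch K r x0 - x0 *m T) = normal_stretch K r x.
  move=> xP; rewrite addrCA -mulmxBl -[RHS](subrKC (normal_stretch K r x0)).
  congr (_ + _).
  (* The difference of the feet is orthogonal to the active constraints and fixed by [T]; the
     difference of the normal vectors lies in their span and is multiplied by [r]. *)
  have -> : x - x0 = (pK x - pK x0) + ((x - pK x) - (x0 - pK x0)).
    by apply/rowP => i; rewrite !mxE; ring.
  have aE y : shell_part 1 A eta y -> active (pK y) = A by case.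
  rewrite mulmxDl (UT (x - pK x - (x0 - pK x0))); last first.
    have nA y : shell_part 1 A eta y -> (y - pK y <= constraint_mx A)%MS.
      by move=> yP; have := normal_in_rowspace y; rewrite (aE _ yP).
    by apply: addmx_sub; [exact: nA|rewrite eqmx_opp; exact: nA].
  rewrite (VT (pK x - pK x0)); last first.
    apply/constraint_mx_orthP => j jA; rewrite dotBr.
    have := jA; rewrite -{1}(aE _ xP) inE => /eqP ->.
    by have := jA; rewrite -{1}(aE _ x0P) inE => /eqP ->; rewrite subrr.
  by rewrite /normal_stretch scalerBr opprD addrACA.
apply/seteqP; split=> [x xP|_ [_ [x xP <-] <-]]; last by rewrite E//; exact: shell_part_stretch.
have yP := shell_part_unstretch r0 xP.
exists (normal_stretch K r^-1 x *m T); first by exists (normal_stretch K r^-1 x).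
by rewrite E// -{1}[r]invrK normal_stretchK// invr_gt0.
Qed.

End PolyhedronSteiner.

Section PolyhedronSupportMeasures.
Context (R : realType) (n : nat) (J : finType) (a : J -> 'rV[R]_n.+1) (b : J -> R).
Implicit Types (x : 'rV[R]_n.+1) (A : {set J}) (r : R) (eta : set (borel_Sigma R n.+1)).

Local Notation K := (polyhedron a b).
Hypothesis convK : convex_body K.
Local Notation pK := (metric_proj K).
Local Notation H := (@hausdorff_measure R n.+1 n.+1).
Local Notation codim A := (\rank (constraint_mx a A)).
Local Open Scope ereal_scope.

Definition face_shell i : set 'rV[R]_n.+1 :=
  outer_shell K 1 `&` [set x | codim (active a b (pK x)) = (n.+1 - i)%N].

Lemma measurable_face_shell i : measurable (face_shell i : set (borel R n.+1)).
Proof.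
apply: measurableI; first exact: measurable_outer_shell.
rewrite (_ : mkset _ = [set x | (fun A => codim A == (n.+1 - i)%N) (active a b (pK x))]).
  exact: (measurable_active convK (fun A => codim A == (n.+1 - i)%N)).
by apply/seteqP; split=> x /= /eqP.
Qed.

Lemma hausdorff_outer_shell r eta : measurable eta ->
  H (outer_shell K r `&` normal_pt K @^-1` eta) =
  \sum_A H (shell_part a b r A eta).
Proof.
move=> me.
apply: (@measure_fibers _ _ _ (borel_hausdorff n.+1) _ (active a b \o pK)) => A.
exact: measurable_shell_part.
Qed.

Lemma hausdorff_face_shell i eta : measurable eta ->
  H (face_shell i `&` normal_pt K @^-1` eta) =
  \sum_(A | codim A == (n.+1 - i)%N) H (shell_part a b 1 A eta).
Proof.
move=> me.
have E A : face_shell i `&` normal_pt K @^-1` eta `&` (active a b \o pK) @^-1` [set A] =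
    if codim A == (n.+1 - i)%N then shell_part a b 1 A eta else set0.
  apply/seteqP; split=> x.
    by move=> [[[xK xc] ex] /= xA]; rewrite -xA xc eqxx; split.
  by case: ifP => // /eqP cA [[xK ex] /= xA]; split => //; split => //; split => //=; rewrite xA.
rewrite [RHS]big_mkcond /=.
have mE A : measurable (face_shell i `&` normal_pt K @^-1` eta
     `&` (active a b \o pK) @^-1` [set A] : set (borel R n.+1)).
  by rewrite E; case: ifP => // _; exact: measurable_shell_part.
rewrite -[LHS]/(borel_hausdorff n.+1 _) (measure_fibers _ mE).
apply: eq_bigr => A _; rewrite /borel_hausdorff /= E; case: ifP => // _; exact: hausdorff_measure0.
Qed.

(** Disposes of rank 0, which matches no index in the Steiner sum: with no normal direction
    available, the point would coincide with its projection. *)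
Lemma shell_part_codim0 r A eta : codim A = 0%N -> shell_part a b r A eta = set0.
Proof.
move=> cA; apply/seteqP; split => // x [[[Kx _] _] /= xA]; apply: Kx.
have := normal_in_rowspace convK x; rewrite xA.
move/eqP : cA; rewrite mxrank_eq0 => /eqP -> /submx0null /eqP.
rewrite subr_eq0 => /eqP ->.
exact: metric_proj_in.
Qed.

Lemma polyhedron_support_measures :
  exists Lam : 'I_n.+1 -> {finite_measure set (borel_Sigma R n.+1) -> \bar R},
    support_measures K Lam /\
    forall i eta, Lam i eta =
      (fine (kappa R (n.+1 - i)))^-1%:E * H (face_shell i `&` normal_pt K @^-1` eta).
Proof.
have k0 j : (0 <= (fine (kappa R j))^-1)%R.
  by rewrite invr_ge0 fine_ge0// ltW// kappa_gt0.
pose m0 (i : 'I_n.+1) : {measure set (borel_Sigma R n.+1) -> \bar R} :=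
  mscale (NngNum (k0 (n.+1 - i)%N)) (pushforward_measure
    (mrestr (borel_hausdorff n.+1) (measurable_face_shell i)) (measurable_normal_pt convK)).
have m0E i eta : m0 i eta =
    (fine (kappa R (n.+1 - i)))^-1%:E * H (face_shell i `&` normal_pt K @^-1` eta).
  by rewrite /m0 /= /mscale /= /pushforward /= /mrestr /= setIC.
have Hfin i eta : H (face_shell i `&` normal_pt K @^-1` eta) \is a fin_num.
  rewrite ge0_fin_numE ?hausdorff_measure_ge0//.
  have [M [_ KM]] : bounded_set K by apply: compact_bounded; case: convK.
  apply: (@hausdorff_bounded_lty _ _ _ (n.+1%:R * (M + 1) + 1)) => x [[[_ x1] _] _].
  rewrite -(subrK (pK x) x) addrC; apply: le_trans (enormD _ _) _; apply: lerD => //.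
  apply: le_trans (enorm_le_norm _) _; apply: ler_wpM2l => //.
  by apply: KM; [rewrite ltrDl|exact: metric_proj_in].
have m0fin i : fin_num_fun (m0 i).
  by move=> eta me; rewrite m0E fin_numM.
pose Lam (i : 'I_n.+1) : {finite_measure set (borel_Sigma R n.+1) -> \bar R} :=
  HB.pack (m0 i : set _ -> \bar R) (Measure.class (m0 i)) (Measure_isFinite.Build _ _ _ (m0 i) (m0fin i)).
exists Lam; split; last by move=> i eta; exact: m0E.
move=> r r0 eta me; rewrite local_parallel_volumeE// hausdorff_outer_shell//.
pose h A := H (shell_part a b 1 A eta).
have h0 A : 0 <= h A by exact: hausdorff_measure_ge0.
transitivity (\sum_A (r ^+ codim A)%:E * h A).
  by apply: eq_bigr => A _; rewrite hausdorff_shell_part.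
(* The active sets are sorted by rank: a rank between 1 and n.+1 equals n.+1 - i for exactly one
   index [i]. *)
transitivity (\sum_A \sum_(i < n.+1)
    (if codim A == (n.+1 - i)%N then (r ^+ (n.+1 - i))%:E * h A else 0)).
  apply: eq_bigr => A _; have [cA|cA] := posnP (codim A).
    have -> : h A = 0 by rewrite /h shell_part_codim0// hausdorff_measure0.
    by rewrite mule0 big1// => i _; rewrite mule0 if_same.
  have cA1 : (codim A <= n.+1)%N by exact: rank_leq_col.
  have ln : (n.+1 - codim A < n.+1)%N by lia.
  rewrite (bigD1 (Ordinal ln))//= subKn// eqxx big1 ?adde0// => i.
  rewrite -val_eqE /= => iA; case: ifP => // /eqP e; exfalso; move: iA.
  by rewrite e subKn ?eqxx// ltnW.
rewrite exchange_big /=; apply: eq_bigr => i _.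
rewrite -[Lam i eta]/(m0 i eta) m0E hausdorff_face_shell//.
rewrite muleA -[X in X * _]muleA.
have -> : kappa R (n.+1 - i) * (fine (kappa R (n.+1 - i)))^-1%:E = 1.
  rewrite -{1}(fineK (kappa_fin_num R (n.+1 - i))) -EFinM divff//.
  by rewrite gt_eqF// fine_gt0// kappa_gt0 -ge0_fin_numE ?kappa_fin_num// ltW// kappa_gt0.
rewrite mule1 ge0_sume_distrr//; last by move=> A _; exact: h0.
by rewrite [RHS]big_mkcond.
Qed.

End PolyhedronSupportMeasures.

(** * Integrals of Lipschitz functions of the normal *)

Section IntegralBounds.
Context d (T : measurableType d) (R : realType).
Variables (mu : {finite_measure set T -> \bar R}) (f : T -> R).
Hypotheses (mf : measurable_fun setT f) (f0 : forall x, 0 <= f x).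

Let mEf : measurable_fun setT (EFin \o f).
Proof. exact/measurable_EFinP. Qed.

Let preimf (A : set R) : measurable A -> measurable (f @^-1` A).
Proof. by move=> mA; rewrite -[X in measurable X]setTI; exact: mf. Qed.

Lemma Rintegral_eq0 : mu [set x | f x != 0] = 0%E -> \int[mu]_x f x = 0.
Proof.
move=> N0; rewrite /Rintegral.
have mN : measurable [set x | f x != 0].
  rewrite (_ : mkset _ = f @^-1` (~` [set 0])).
    by apply: preimf; exact: measurableC.
  by apply/seteqP; split=> x /= /eqP.
rewrite (@ge0_negligible_integral _ _ _ mu setT [set x | f x != 0])//; last first.
  by move=> x _; rewrite lee_fin.
rewrite integral0_eq// => x [_ /= /negP]; rewrite negbK => /eqP ->.
by [].
Qed.

(** Markov's inequality; the bound by 1 keeps the integral finite, so that its real value is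
    faithful. *)
Lemma le_Rintegral_level (e : R) : 0 <= e -> (forall x, f x <= 1) ->
  e * fine (mu [set x | e <= f x]) <= \int[mu]_x f x.
Proof.
move=> e0 f1; rewrite /Rintegral -lee_fin.
pose E := [set x | e <= f x].
have mE : measurable E.
  rewrite (_ : E = f @^-1` `[e, +oo[%classic); first by apply: preimf; exact: measurable_itv.
  by apply/seteqP; split=> x; rewrite /E/= in_itv/= andbT.
have mufin A : measurable A -> mu A \is a fin_num by exact: fin_num_measure.
have Efin : (\int[mu]_x (f x)%:E)%E \is a fin_num.
  rewrite ge0_fin_numE; last by apply: integral_ge0 => x _; rewrite lee_fin.
  apply: (@le_lt_trans _ _ (\int[mu]_x (cst 1%E x))%E).
    by apply: ge0_le_integral => //= x _; rewrite lee_fin.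
  by rewrite integral_cst// mul1e -ge0_fin_numE// mufin.
rewrite fineK// EFinM fineK ?mufin// -integral_cst//.
apply: (@le_trans _ _ (\int[mu]_(x in E) (f x)%:E)%E).
  by apply: ge0_le_integral => //; exact: measurable_funS mEf.
by apply: ge0_subset_integral => // x _; rewrite lee_fin.
Qed.

End IntegralBounds.

Section LipschitzOnSphere.
Context (R : realType) (n : nat) (phi : 'rV[R]_n.+1 -> R).
Hypothesis phi_lip : forall u v, `|phi u - phi v| <= enorm (u - v).
Hypothesis phi_bd : forall u, enorm u = 1 -> `|phi u| <= 1.

Definition normal_fun (a : Sigma R n.+1) : R := phi (val a).2.

Lemma normal_fun_lip_norm : (lip_norm normal_fun <= 1)%E.
Proof.
apply: ge_ereal_sup => _ [[p q] /= _ <-]; rewrite lee_fin.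
have le_dist : `|normal_fun p - normal_fun q| <= Sigma_dist p q.
  apply: le_trans (phi_lip _ _) _; rewrite /Sigma_dist.
  rewrite -[leLHS]ger0_norm ?enorm_ge0// -sqrtr_sqr ler_wsqrtr// lerDr.
  exact: sqr_ge0.
(* At distance 0 the quotient is 0, by the convention for the inverse of 0. *)
have [d0|d0] := eqVneq (Sigma_dist p q) 0; first by rewrite d0 invr0 mulr0.
by rewrite ler_pdivrMr ?mul1r// lt_def d0 sqrtr_ge0.
Qed.

Lemma normal_fun_bounded a : `|normal_fun a| <= 1.
Proof. by apply: phi_bd; have /set_mem := valP a. Qed.

Lemma normal_fun_sup_norm : (sup_norm normal_fun <= 1)%E.
Proof.
by apply: ge_ereal_sup => _ [a _ <-]; rewrite lee_fin normal_fun_bounded.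
Qed.

Lemma normal_fun_measurable : measurable_fun setT (normal_fun : borel_Sigma R n.+1 -> R).
Proof.
apply: (measurability _ (RGenOpens.measurableE R)) => _ [U [x [y ->]] <-]; rewrite setTI.
apply: sub_sigma_algebra.
exists ((fun p : 'rV[R]_n.+1 * 'rV[R]_n.+1 => phi p.2) @^-1` `]x, y[%classic) => //.
apply: (@open_comp _ _ (fun p : 'rV[R]_n.+1 * 'rV[R]_n.+1 => phi p.2)); last exact: interval_open.
move=> p _.
have c2 : continuous (snd : 'rV[R]_n.+1 * 'rV[R]_n.+1 -> 'rV[R]_n.+1) by move=> q; exact: cvg_snd.
apply: (@continuous_comp _ _ _ snd phi); first exact: c2.
by apply: (@lipschitz_continuous _ _ R^o phi 1) => u v; rewrite mul1r.
Qed.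

Lemma dbL_normal_fun (mu nu : {finite_measure set (borel_Sigma R n.+1) -> \bar R}) :
  ((`|\int[mu]_a normal_fun a - \int[nu]_a normal_fun a|)%:E <= dbL mu nu)%E.
Proof.
apply: ereal_sup_ubound; exists normal_fun => //; split.
  exact: normal_fun_lip_norm.
exact: normal_fun_sup_norm.
Qed.

End LipschitzOnSphere.

(** * Bodies bounded by tangents of a parabola *)

Lemma polyhedron_convex_body (R : realType) n (J : finType) (a : J -> 'rV[R]_n.+1)
    (b : J -> R) (r : R) :
  polyhedron a b !=set0 -> (forall x, polyhedron a b x -> enorm x <= r) ->
  convex_body (polyhedron a b).
Proof.
move=> K0 Kr; split => //.
  apply: bounded_closed_compact.
    exists r; split; first exact: num_real.
    by move=> M rM x /Kr xr; rewrite /= (le_trans (norm_le_enorm x))// (le_trans xr)// ltW.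
  rewrite (_ : polyhedron a b = \bigcap_j [set x | dot (a j) x <= b j]); last first.
    by apply/seteqP; split=> x h j; [move=> _; exact: h|exact: h].
  apply: closed_bigI => j _.
  apply: (@preimage_closed _ _ (dot (a j)) [set y | y <= b j]); last exact: closed_le.
  by move=> x _; exact: dot_continuous.
move=> x y t /set_mem Kx /set_mem Ky; apply: mem_set => j.
suff : dot (a j) (t%:num *: x + (1 - t%:num) *: y) <= b j by [].
rewrite dotDr !dotZr.
have t0 : 0 <= t%:num by [].
have t1 : 0 <= 1 - t%:num by rewrite subr_ge0.
have := ler_wpM2l t0 (Kx j); have := ler_wpM2l t1 (Ky j); lra.
Qed.

Section TangentBody.
Context (R : realType) (n : nat) (i : 'I_n.+2).
Hypothesis i_gt0 : (0 < i)%N.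
Implicit Types (N : nat) (x u v w p : 'rV[R]_n.+2).

Let i_neq0 : i != 0.
Proof. by rewrite -lt0n. Qed.

(** Coordinates beyond [i] are pinned at 0 by two opposite constraints; the body then has dimension
    i + 1, and its i-faces are its facets. *)
Definition upper_bound_coord (j : 'I_n.+2) : R := if (j <= i)%N then 1 else 0.

Definition slope N k : R := 2 * k%:R / N%:R.

(* [inl k] is the tangent to the parabola x_i = x_0^2 at x_0 = k / N;
   [inr (j, true)] and [inr (j, false)] bound x_j from above and below. *)
Definition tangent_index N : finType := ('I_N.+1 + 'I_n.+2 * bool)%type.

Definition tangent_normal N (c : tangent_index N) : 'rV[R]_n.+2 :=
  match c with
  | inl k => slope N k *: delta_mx 0 0 - delta_mx 0 i
  | inr (j, up) => if up then delta_mx 0 j else - delta_mx 0 j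
  end.

Definition tangent_offset N (c : tangent_index N) : R :=
  match c with
  | inl k => (k%:R / N%:R) ^+ 2
  | inr (j, up) => if up then upper_bound_coord j else 0
  end.

Definition tangent_body N : set 'rV[R]_n.+2 :=
  polyhedron (@tangent_normal N) (@tangent_offset N).

Lemma dot_delta j x : dot (delta_mx 0 j) x = x 0 j.
Proof.
rewrite /dot (bigD1 j)//= mxE !eqxx mul1r big1 ?addr0// => l lj.
by rewrite mxE (negbTE lj) andbF mul0r.
Qed.

Lemma dot_tangent N (k : 'I_N.+1) x :
  dot (tangent_normal (inl k)) x = slope N k * x 0 0 - x 0 i.
Proof. by rewrite /= dotBl dotZl !dot_delta. Qed.

Lemma tangent_bodyP N x : tangent_body N x <->
  (forall j, 0 <= x 0 j <= upper_bound_coord j) /\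
  (forall k : 'I_N.+1, slope N k * x 0 0 - x 0 i <= (k%:R / N%:R) ^+ 2).
Proof.
split=> [Kx|[Kj Kk] [k|[j []]]].
- split=> [j|k]; last by have := Kx (inl k); rewrite dot_tangent.
  have := Kx (inr (j, true)); have := Kx (inr (j, false)).
  by rewrite /= dotNl dot_delta oppr_le0 => -> ->.
- by rewrite dot_tangent.
- by rewrite /= dot_delta; case/andP: (Kj j).
- by rewrite /= dotNl dot_delta oppr_le0; case/andP: (Kj j).
Qed.

Lemma upper_bound_coord_le1 j : upper_bound_coord j <= 1.
Proof. by rewrite /upper_bound_coord; case: ifP. Qed.

Lemma tangent_body_bounded N x : tangent_body N x -> enorm x <= n.+2%:R.
Proof.
move=> /tangent_bodyP[Kj _]; rewrite -[leRHS]mulr1; apply: enorm_le_coord => // j.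
by have /andP[x0 x1] := Kj j; rewrite ger0_norm// (le_trans x1)// upper_bound_coord_le1.
Qed.

Lemma tangent_body_convex N : convex_body (tangent_body N).
Proof.
apply: polyhedron_convex_body (@tangent_body_bounded N).
exists 0; apply/tangent_bodyP; split=> [j|k]; rewrite !mxE ?mulr0 ?subr0 ?sqr_ge0//.
by rewrite /upper_bound_coord; case: ifP => _; rewrite ?lexx ?ler01.
Qed.

(** The index k = 0 contributes |u_0|, which vanishes on the normals of facets where x_i is 0 or 1;
    the initial value |u_i| takes care of the facets given by the other coordinates. *)
Definition slope_gap N u : R :=
  \big[Num.min/`|u 0 i|]_(k < N.+1) `|u 0 0 + slope N k * u 0 i|.

Lemma slope_gap_ge0 N u : 0 <= slope_gap N u.
Proof. by rewrite /slope_gap; apply: le_bigmin => // k _; exact: normr_ge0. Qed.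

Lemma slope_gap_le N u (k : 'I_N.+1) : slope_gap N u <= `|u 0 0 + slope N k * u 0 i|.
Proof. by rewrite /slope_gap; apply: bigmin_le_cond. Qed.

Local Notation codim N A := (\rank (constraint_mx (@tangent_normal N) A)).

(** The directions of an i-face form a space of dimension i, so it contains some w != 0 in the plane
    of x_0 and x_i, to which the normal u is orthogonal. An active tangent k forces w_i = slope w_0,
    hence u_0 + slope u_i = 0; an active bound on x_i forces w_i = 0, hence u_0 = 0; without either,
    the i-th basis vector is a direction of the face and u_i = 0. *)
Lemma slope_gap_face N x :
  face_shell (@tangent_normal N) (@tangent_offset N) i x ->
  slope_gap N (unit_normal (tangent_body N) x) = 0.
Proof.
move=> [_ /= cA]; have convK := tangent_body_convex N.
set A := active _ _ _ in cA; set u := unit_normal _ _.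
have Kp := metric_proj_in convK x; set p := metric_proj _ _ in Kp A u cA *.
have u_orth w : (forall c, c \in A -> dot (tangent_normal c) w = 0) -> dot u w = 0.
  by move=> /(active_orthogonal convK) xw; rewrite /u /unit_normal dotZl xw mulr0.
suff [ui0|[k k0]] : u 0 i = 0 \/ exists k : 'I_N.+1, u 0 0 + slope N k * u 0 i = 0.
- apply/eqP; rewrite eq_le slope_gap_ge0 andbT.
  by apply: le_trans (bigmin_le_id _ _ _ _) _; rewrite ui0 normr0.
- apply/eqP; rewrite eq_le slope_gap_ge0 andbT.
  by apply: le_trans (slope_gap_le u k) _; rewrite k0 normr0.
have delta_ortho (l j : 'I_n.+2) up : l != j ->
    dot (tangent_normal (inr (l, up) : tangent_index N)) (delta_mx 0 j) = 0.
  by move=> lj; case: up => /=; rewrite ?dotNl dot_delta mxE (negbTE lj) ?andbF ?oppr0.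
have u_delta j : dot u (delta_mx 0 j) = u 0 j by rewrite dotC dot_delta.
(* A nonzero direction of the face lying in the plane of the parabola. *)
have [w [w0 wA wj]] : exists w : 'rV[R]_n.+2, [/\ w != 0,
    forall c, c \in A -> dot (tangent_normal c) w = 0 &
    forall j, j != 0 -> j != i -> w 0 j = 0].
  (* [P] extracts the coordinates 1 to i - 1: only i - 1 equations on the i-dimensional space
     [D]. *)
  pose P : 'M[R]_(n.+2, i.-1) := \matrix_(j, l) (j == l.+1 :> nat)%:R.
  set C := constraint_mx _ A in cA; pose D := kermx C^T.
  have Di : \rank D = i.
    by rewrite mxrank_ker mxrank_tr cA subKn// ltnW.
  have : (D :&: kermx P)%MS != 0.
    rewrite -mxrank_eq0 -lt0n; have := mxrank_mul_ker D P.
    have := rank_leq_col (D *m P); rewrite Di; lia.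
  move=> /rowV0Pn[w]; rewrite sub_capmx => /andP[wD /sub_kermxP wP] w0.
  have wA c : c \in A -> dot (tangent_normal c) w = 0.
    by move/sub_kermxP : wD => /constraint_mx_orthP; exact.
  exists w; split => // j j0 ji.
  have [lt_ij|le_ji] := ltnP i j.
    have : inr (j, true) \in A.
      rewrite inE /= dot_delta; have /(tangent_bodyP) [/(_ j)] := Kp.
      by rewrite /upper_bound_coord leqNgt lt_ij /= eq_le => /andP[-> ->].
    by move=> /wA; rewrite /= dot_delta.
  have j_lt_i : (j < i)%N by rewrite ltn_neqAle le_ji andbT.
  have jP : (j.-1 < i.-1)%N by move: j0; rewrite -val_eqE /=; lia.
  have := congr1 (fun t : 'rV_ _ => t 0 (Ordinal jP)) wP.
  rewrite !mxE (bigD1 j)//= mxE /= prednK ?lt0n// eqxx mulr1 big1 ?addr0// => l lj.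
  by rewrite mxE /= prednK ?lt0n// (_ : (l == j :> nat) = false) ?mulr0//; exact/negbTE.
have w0i : w 0 0 != 0 \/ w 0 i != 0.
  apply: contrapT => /not_orP[/negP + /negP]; rewrite !negbK => /eqP w00 /eqP wi0.
  move/eqP : w0; apply; apply/rowP => j; rewrite mxE.
  have [->//|j0] := eqVneq j 0; have [->//|ji] := eqVneq j i.
  exact: wj.
have uw : u 0 0 * w 0 0 + u 0 i * w 0 i = 0.
  rewrite -(u_orth w wA) /dot (bigD1 0)//= (bigD1 i)//= big1 ?addr0// => j /andP[j0 ji].
  by rewrite wj// mulr0.
have [[k kA]|noK] := pselect (exists k, inl k \in A).
  right; exists k; have := wA _ kA; rewrite dot_tangent => /eqP; rewrite subr_eq0 => /eqP wi.
  have w00 : w 0 0 != 0.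
    by case: w0i => //; rewrite -wi; apply: contra => /eqP ->; rewrite mulr0.
  by apply: (mulIf w00); rewrite mul0r -uw -wi; ring.
have [[up iA]|noi] := pselect (exists up, inr (i, up) \in A); last first.
  left; rewrite -u_delta; apply: u_orth => -[k|[l up]] cAc.
    by exfalso; apply: noK; exists k.
  by apply: delta_ortho; apply/eqP => li; apply: noi; exists up; rewrite -li.
(* The tangent at 0 has slope 0, so its term is |u_0|. *)
right; exists 0; rewrite /slope /= mulr0 !mul0r addr0.
have wi : w 0 i = 0.
  by have := wA _ iA; case: (up) => /=; rewrite ?dotNl dot_delta // => /eqP; rewrite oppr_eq0 => /eqP.
have w00 : w 0 0 != 0 by case: w0i => //; rewrite wi eqxx.
by apply: (mulIf w00); rewrite mul0r -uw wi mulr0 addr0.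
Qed.

End TangentBody.

(** The inverse [g], chosen on the image, is 1-Lipschitz. *)
Lemma hausdorff_measure_expanding (R : realType) n s (f : 'rV[R]_n -> 'rV[R]_n)
    (A : set 'rV[R]_n) :
  (forall x y, A x -> A y -> enorm (x - y) <= enorm (f x - f y)) ->
  (hausdorff_measure s A <= hausdorff_measure s (f @` A))%E.
Proof.
move=> expf; pose g z := xget 0 [set y | A y /\ f y = z].
have gP y : A y -> A (g (f y)) /\ f (g (f y)) = f y.
  by move=> Ay; apply: (@xgetPex _ 0 [set y' | A y' /\ f y' = f y]); exists y.
apply: (@le_trans _ _ (hausdorff_measure s (g @` (f @` A)))); last first.
  apply: hausdorff_measure_lipschitz => _ _ [x Ax <-] [y Ay <-].
  have [Ax' e1] := gP _ Ax; have [Ay' e2] := gP _ Ay.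
  by rewrite -{2}e1 -{2}e2; apply: expf.
apply: le_outer_measure => y Ay; exists (f y); first by exists y.
have [Ay' e] := gP _ Ay; apply/eqP; rewrite -subr_eq0 -enorm_eq0 eq_le enorm_ge0 andbT.
by apply: le_trans (expf _ _ Ay' Ay) _; rewrite e subrr enorm0.
Qed.

(** * Boxes of points projecting to one tangent edge *)

Section TangentEdge.
Context (R : realType) (n : nat) (i : 'I_n.+2).
Hypothesis i_gt0 : (0 < i)%N.
Context (M : nat) (j : 'I_M.+1).
Hypotheses (j_gt0 : (0 < j)%N) (j_ltM : (j < M)%N).
Implicit Types (x y u v w p : 'rV[R]_n.+2) (l : 'I_n.+2).

Let i_neq0 : i != 0. Proof. by rewrite -lt0n. Qed.
Let i_neq0' : (0 == i) = false. Proof. by rewrite eq_sym; exact/negbTE. Qed.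

Local Notation K := (@tangent_body R n i M).
Local Notation sigma := (slope R M j).
Let t : R := j%:R / M%:R.

(** Slopes are at most 2 and box coordinates below 2 [delta], so the normal vector of a lifted point
    has n.+2 coordinates of size at most 4 [delta] and length at most 1. *)
Definition edge_thickness : R := (4 * n.+2%:R)^-1.
Local Notation delta := edge_thickness.

Lemma edge_thickness_gt0 : 0 < delta.
Proof. by rewrite invr_gt0 mulr_gt0. Qed.

(** The tangent at t is the highest one for x_0 within 1 / (2 M) of t; the box lies over the right
    half. Keeping the other coordinates in [[delta], 2 [delta]) keeps the foot off their bounds and
    the height above the edge at least [delta]. *)
Definition edge_box : set 'rV[R]_n.+2 := [set y |
  t <= y 0 0 < t + (2 * M%:R)^-1 /\ forall l, l != 0 -> delta <= y 0 l < 2 * delta].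

Definition edge_foot y : 'rV[R]_n.+2 := \row_l
  (if l == 0 then y 0 0 else if l == i then sigma * y 0 0 - t ^+ 2
   else if (l < i)%N then y 0 l else 0).

(* Coordinates in the frame of the edge: [y 0 i] is the height above it. *)
Definition edge_lift y : 'rV[R]_n.+2 := \row_l
  (if l == 0 then y 0 0 + sigma * y 0 i
   else if l == i then sigma * y 0 0 - t ^+ 2 - y 0 i else y 0 l).

Definition edge_active : {set tangent_index n M} :=
  finset (fun c : tangent_index n M =>
    match c with inl k => k == j | inr (l, _) => (i < l)%N end).

Let M_gt0 : (0 : R) < M%:R.
Proof. by rewrite ltr0n (leq_trans _ j_ltM). Qed.

Let sigmaE k : slope R M k = 2 * (k%:R / M%:R).
Proof. by rewrite /slope mulrA. Qed.

Let invM : M%:R^-1 = 2 * (2 * M%:R)^-1 :> R.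
Proof. by field; rewrite gt_eqF. Qed.

Let h : R := (2 * M%:R)^-1.
Let h_gt0 : 0 < h. Proof. by rewrite invr_gt0 mulr_gt0. Qed.

(** The difference of the tangents at t and c factors as (t - c) (2 s - (t + c)). Since c is at
    least 2 h away from t, both factors have the same sign. *)
Lemma tangent_gap (s : R) (k : 'I_M.+1) : t <= s < t + h -> k != j ->
  slope R M k * s - (k%:R / M%:R) ^+ 2 < sigma * s - t ^+ 2.
Proof.
move=> /andP[ts st] kj; rewrite !sigmaE -/t; set c := k%:R / M%:R.
have step (a b : nat) : (a < b)%N -> a%:R / M%:R + 2 * h <= b%:R / M%:R :> R.
  move=> ab; rewrite /h -invM.
  have -> : a%:R / M%:R + M%:R^-1 = a.+1%:R / M%:R :> R by rewrite -natr1 mulrDl mul1r.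
  by rewrite ler_pM2r ?invr_gt0// ler_nat.
rewrite -subr_gt0.
have -> : 2 * t * s - t ^+ 2 - (2 * c * s - c ^+ 2) = (t - c) * (2 * s - (t + c)) by ring.
move: kj; rewrite -val_eqE neq_ltn /= => /orP[/step|/step]; rewrite -/t -/c => tc.
  by rewrite mulr_gt0//; lra.
by rewrite nmulr_rgt0; lra.
Qed.

Section Point.
Variable y : 'rV[R]_n.+2.
Hypothesis yB : edge_box y.

Let yl l : l != 0 -> delta <= y 0 l < 2 * delta.
Proof. by case: yB => _; exact. Qed.

Let y0 : t <= y 0 0 < t + h. Proof. by case: yB. Qed.

Let d2_lt1 : 2 * delta < 1.
Proof.
rewrite /delta invfM mulrA mulrC ltr_pdivrMl// mulr1.
by apply: (@lt_le_trans _ _ 1); [lra|rewrite ler1n].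
Qed.

Let sigma_bd : 0 <= sigma <= 2.
Proof.
rewrite sigmaE; apply/andP; split; first by rewrite mulr_ge0// divr_ge0.
by rewrite ler_piMr// ler_pdivrMr// mul1r ler_nat ltnW.
Qed.

Let t_bd : 2 * h <= t /\ t + 2 * h <= 1.
Proof.
rewrite /h -invM /t; split.
  by rewrite -[leLHS]mul1r ler_pM2r ?invr_gt0// ler1n.
have -> : j%:R / M%:R + M%:R^-1 = j.+1%:R / M%:R :> R by rewrite -natr1 mulrDl mul1r.
by rewrite ler_pdivrMr// mul1r ler_nat.
Qed.

Let foot0 : edge_foot y 0 0 = y 0 0. Proof. by rewrite mxE eqxx. Qed.
Let footi : edge_foot y 0 i = sigma * y 0 0 - t ^+ 2.
Proof. by rewrite mxE (negbTE i_neq0) eqxx. Qed.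
Let foot_lt l : l != 0 -> (l < i)%N -> edge_foot y 0 l = y 0 l.
Proof. by move=> l0 li; rewrite mxE (negbTE l0) -val_eqE ltn_eqF// li. Qed.
Let foot_gt l : (i < l)%N -> edge_foot y 0 l = 0.
Proof.
move=> il; rewrite mxE -(val_eqE l i) gtn_eqF// ltnNge (ltnW il)/=.
by rewrite -val_eqE /= gtn_eqF// (leq_trans _ il).
Qed.

Let footi_bd : 0 < edge_foot y 0 i < 1.
Proof.
have /andP[y1 y2] := y0; have [t1 t2] := t_bd; rewrite footi sigmaE -/t.
have -> : 2 * t * y 0 0 - t ^+ 2 = t * (2 * y 0 0 - t) by ring.
apply/andP; split; first by rewrite mulr_gt0//; have := h_gt0; lra.
(* The tangent lies below the parabola. *)
have : t * (2 * y 0 0 - t) <= y 0 0 ^+ 2 by rewrite -subr_ge0; have := sqr_ge0 (y 0 0 - t); lra.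
move=> /le_lt_trans; apply; rewrite expr_lt1//; first by have := h_gt0; lra.
by have := h_gt0; lra.
Qed.

Let foot_lt_bd l : (l < i)%N -> 0 < edge_foot y 0 l < 1.
Proof.
move=> li; have [->|l0] := eqVneq l 0.
  by rewrite foot0; have /andP[y1 y2] := y0; have [t1 t2] := t_bd; have := h_gt0 => h0;
     apply/andP; split; lra.
rewrite foot_lt//; have /andP[y1 y2] := yl l0; have d0 := edge_thickness_gt0.
by apply/andP; split; [exact: lt_le_trans y1|exact: lt_trans y2 d2_lt1].
Qed.

Let foot_bd l : (l <= i)%N -> 0 < edge_foot y 0 l < 1.
Proof. by rewrite leq_eqVlt => /predU1P[/val_inj ->//|/foot_lt_bd]. Qed.

Lemma edge_foot_in : K (edge_foot y).
Proof.
apply/tangent_bodyP; split=> [l|k].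
  rewrite /upper_bound_coord; have [/foot_bd/andP[f1 f2]|/foot_gt ->] := leqP l i.
    by rewrite !ltW.
  by rewrite lexx.
rewrite foot0 footi; have [->|/(tangent_gap y0)] := eqVneq k j; first by rewrite -/t; lra.
by move=> kj; lra.
Qed.

Lemma edge_foot_active :
  active (@tangent_normal R n i M) (@tangent_offset R n i M) (edge_foot y) = edge_active.
Proof.
apply/setP => -[k|[l up]]; rewrite !inE.
  rewrite dot_tangent foot0 footi /tangent_offset.
  have [->|kj] := eqVneq k j; first by apply/eqP; rewrite -/t; lra.
  by apply/negbTE/eqP => e; have := tangent_gap y0 kj; rewrite -e; lra.
rewrite /= /upper_bound_coord; have [/foot_bd/andP[f1 f2]|/foot_gt e] := leqP l i.
  by case: up; rewrite ?dotNl dot_delta ?oppr_eq0; apply/negbTE; rewrite ?(lt_eqF f2)// ?(gt_eqF f1).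
by case: up; rewrite ?dotNl dot_delta e ?oppr0 eqxx.
Qed.

Let normal_i : (edge_lift y - edge_foot y) 0 i = - y 0 i.
Proof. by rewrite !mxE (negbTE i_neq0) eqxx; ring. Qed.
Let normal_0 : (edge_lift y - edge_foot y) 0 0 = sigma * y 0 i.
Proof. by rewrite !mxE eqxx; ring. Qed.

(** The vector from foot to lift is y_i times the normal of tangent [j], plus a part in the
    coordinates beyond [i], where the body is pinned; so it lies in the normal cone at the foot. *)
Lemma edge_lift_proj : metric_proj K (edge_lift y) = edge_foot y.
Proof.
apply: (metric_proj_eq (tangent_body_convex R i M)); first exact: edge_foot_in.
move=> z /tangent_bodyP[zj zk].
rewrite /dot (bigD1 0)//= (bigD1 i)//= big1 => [|l /andP[l0 li]]; last first.
  rewrite !mxE (negbTE l0) (negbTE li).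
  have [il|li'|/val_inj e] := ltngtP l i; last by rewrite e eqxx in li.
    by rewrite subrr mul0r.
  have := zj l; rewrite /upper_bound_coord leqNgt li' /= -eq_le => /eqP <-.
  by rewrite subrr mulr0.
have zd l : (z - edge_foot y) 0 l = z 0 l - edge_foot y 0 l by rewrite !mxE.
rewrite addr0 normal_0 normal_i !zd foot0 footi.
have yi : 0 <= y 0 i by have /andP[y1 _] := yl i_neq0; exact: le_trans (ltW edge_thickness_gt0) y1.
have := ler_wpM2l yi (zk j); rewrite -/t; nra.
Qed.

Lemma edge_lift_dist : delta <= dist_to K (edge_lift y) <= 1.
Proof.
rewrite /dist_to edge_lift_proj; apply/andP; split.
  apply: le_trans _ (le_coord_enorm _ i); rewrite normal_i normrN.
  by have /andP[y1 _] := yl i_neq0; apply: le_trans y1 (ler_norm _).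
have -> : 1 = n.+2%:R * (4 * delta) :> R.
  by rewrite /delta invfM mulVKf ?divff// pnatr_eq0.
apply: enorm_le_coord => [|l]; first by rewrite mulr_ge0// ltW// edge_thickness_gt0.
have d0 := edge_thickness_gt0.
have [->|l0] := eqVneq l 0.
  have /andP[y1 y2] := yl i_neq0; have /andP[s1 s2] := sigma_bd.
  have yi0 : 0 <= y 0 i by rewrite (le_trans (ltW d0)).
  by rewrite normal_0 ger0_norm ?mulr_ge0//; nra.
have /andP[y1 y2] := yl l0.
have [->|li] := eqVneq l i; first by
  have /andP[z1 z2] := yl i_neq0; rewrite normal_i normrN ger0_norm; lra.
rewrite !mxE (negbTE l0) (negbTE li); case: ifP => _.
  by rewrite subrr normr0 mulr_ge0// ltW.
by rewrite subr0 ger0_norm; lra.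
Qed.

Lemma edge_lift_out : ~ K (edge_lift y).
Proof.
have /andP[d1 _] := edge_lift_dist; have := lt_le_trans edge_thickness_gt0 d1.
by rewrite (dist_to_gt0 (tangent_body_convex R i M)) => /negP + Ky; apply; exact: mem_set.
Qed.

Lemma edge_lift_normal : delta <= `|unit_normal K (edge_lift y) 0 i| /\
  unit_normal K (edge_lift y) 0 0 = - sigma * unit_normal K (edge_lift y) 0 i.
Proof.
have /andP[d1 d2] := edge_lift_dist; have d0 := lt_le_trans edge_thickness_gt0 d1.
have nE l : unit_normal K (edge_lift y) 0 l =
    (dist_to K (edge_lift y))^-1 * (edge_lift y - edge_foot y) 0 l.
  by rewrite /unit_normal edge_lift_proj mxE.
rewrite !nE normal_i normal_0; split; last by ring.
have /andP[y1 _] := yl i_neq0.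
rewrite normrM normrN gtr0_norm ?invr_gt0// mulrC ler_pdivlMr//.
apply: le_trans (ler_norm _); apply: le_trans y1.
by rewrite ler_piMr// ltW// edge_thickness_gt0.
Qed.

End Point.

(** In the plane of x_0 and x_i the cross terms cancel, and squared lengths are multiplied by 1 +
    sigma^2; the other coordinates are kept. *)
Lemma edge_lift_expanding x y : enorm (x - y) <= enorm (edge_lift x - edge_lift y).
Proof.
rewrite -(@ler_pXn2r _ 2%N) ?nnegrE ?enorm_ge0// !enorm_sqr.
set v := x - y; set w := edge_lift x - edge_lift y.
have w0 : w 0 0 = v 0 0 + sigma * v 0 i by rewrite !mxE eqxx; ring.
have wi : w 0 i = sigma * v 0 0 - v 0 i by rewrite !mxE (negbTE i_neq0) eqxx; ring.
have wl l : l != 0 -> l != i -> w 0 l = v 0 l.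
  by move=> l0 li; rewrite !mxE (negbTE l0) (negbTE li).
rewrite /dot (bigD1 0)//= (bigD1 i)//= [leRHS](bigD1 0)//= [X in _ <= _ + X](bigD1 i)//=.
rewrite [X in _ <= _ + (_ + X)](eq_bigr (fun l => v 0 l * v 0 l)) => [|l /andP[l0 li]]; last first.
  by rewrite wl.
rewrite !addrA lerD2r w0 wi -!expr2.
have := sqr_ge0 (sigma * v 0 0); have := sqr_ge0 (sigma * v 0 i).
by rewrite !exprMn; nra.
Qed.

Lemma hausdorff_edge_box : (hausdorff_measure n.+2 edge_box =
  ((2 * M%:R)^-1 * \prod_(l < n.+2 | l != 0) delta)%:E *
  hausdorff_measure n.+2 (dyadic_cube 0 [ffun=> 0%R] : set 'rV[R]_n.+2))%E.
Proof.
pose d : 'rV[R]_n.+2 := \row_l (if l == 0 then h else delta).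
pose v : 'rV[R]_n.+2 := \row_l (if l == 0 then t else delta).
have d0 l : 0 < d 0 l by rewrite mxE; case: ifP => _ //; exact: edge_thickness_gt0.
have -> : h * \prod_(l < n.+2 | l != 0) delta = \prod_l d 0 l.
  rewrite [RHS](bigD1 0)//= mxE eqxx; congr (_ * _).
  by apply: eq_bigr => l l0; rewrite mxE (negbTE l0).
rewrite -(scales_hausdorff_diag d0); last exact: measurable_dyadic_cube.
rewrite -[RHS](hausdorff_measure_translate n.+2 v); congr hausdorff_measure.
rewrite unit_cubeE; apply/seteqP; split=> [y [y0 yl]|_ [_ [x x01 <-] <-]].
  exists (y - v); last by rewrite subrK.
  exists (\row_l ((y - v) 0 l / d 0 l)).
    move=> l; rewrite mxE ler_pdivlMr// mul0r ltr_pdivrMr// mul1r !mxE.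
    have [->|l0] := eqVneq l 0.
      by have /andP[y1 y2] := y0; apply/andP; split; rewrite /h; lra.
    by have /andP[y1 y2] := yl l l0; apply/andP; split; lra.
  by apply/rowP => l; rewrite mul_mx_diag !mxE divfK//; have := d0 l; rewrite mxE => /gt_eqF ->.
have x01' l : 0 <= x 0 l < 1 := x01 l.
split=> [|l l0]; rewrite mul_mx_diag !mxE /=.
  by have /andP[x1 x2] := x01' 0; rewrite -/h; have h0 := h_gt0; apply/andP; split; nra.
rewrite (negbTE l0); have /andP[x1 x2] := x01' l.
by have d0' := edge_thickness_gt0; apply/andP; split; nra.
Qed.

(** The active normals span the same space as the rows of [W]: the unipotent [L] replaces the basis
    vector e_i by e_i - sigma e_0, the tangent normal up to sign, and [copid_mx i] keeps the rows
    from [i] on. *)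
Lemma edge_codim : \rank (constraint_mx (@tangent_normal R n i M) edge_active) = (n.+2 - i)%N.
Proof.
set C := constraint_mx _ _.
pose E : 'M[R]_n.+2 := delta_mx i 0.
pose L : 'M[R]_n.+2 := 1%:M - sigma *: E.
have E2 : E *m E = 0 by rewrite mul_delta_mx_cond i_neq0' mulr0n.
have uL : L \in unitmx.
  have : L *m (1%:M + sigma *: E) = 1%:M.
    rewrite mulmxDr mulmx1 /L mulmxBl mul1mx -scalemxAl -scalemxAr E2 !scaler0 subr0.
    by rewrite subrK.
  by move=> /mulmx1_unit[].
pose W : 'M[R]_n.+2 := copid_mx i *m L.
have copidE a b : (copid_mx i : 'M[R]_n.+2) a b = ((a == b) && (i <= a)%N)%:R.
  by rewrite !mxE [(i <= a)%N]leqNgt -val_eqE /=; case: (a == b :> nat); case: (a < i)%N; rewrite /= ?subrr ?subr0.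
have rowW l : row l W = if (i <= l)%N then
    delta_mx 0 l - (l == i)%:R * sigma *: delta_mx 0 0 else 0.
  apply/rowP => c; rewrite mxE [LHS]mxE (bigD1 l)//= big1 ?addr0 => [|b bl]; last first.
    by rewrite copidE eq_sym (negbTE bl) mul0r.
  rewrite copidE eqxx; case: (i <= l)%N => /=; last by rewrite mul0r mxE.
  rewrite mul1r !mxE eqxx /= (eq_sym l c) mulrC.
  by case: (l == i); case: (c == 0); rewrite /= ?(mul0r, mul1r, mulr0, mulr1).
have rowWi : row i W = delta_mx 0 i - sigma *: delta_mx 0 0.
  by rewrite rowW leqnn eqxx mul1r.
have rowWl l : (i < l)%N -> row l W = delta_mx 0 l.
  by move=> il; rewrite rowW ltnW// -val_eqE gtn_eqF// mul0r scale0r subr0.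
have rowC c : c \in edge_active -> row (enum_rank c) C = tangent_normal R i c.
  by move=> cA; rewrite rowK enum_rankK cA.
have CW : (C <= W)%MS.
  apply/row_subP => k; rewrite rowK; case: ifP => [|_]; last exact: sub0mx.
  case: (enum_val k) => [k'|[l up]]; rewrite inE /=.
    by move=> /eqP ->; rewrite -opprB -rowWi eqmx_opp row_sub.
  by move=> /rowWl <-; case: up; rewrite ?eqmx_opp row_sub.
have WC : (W <= C)%MS.
  apply/row_subP => l; have [il|li] := leqP i l; last by rewrite rowW leqNgt li sub0mx.
  move: il; rewrite leq_eqVlt => /predU1P[/val_inj <-|il].
    rewrite rowWi -opprB eqmx_opp -[X in (X <= _)%MS]/(tangent_normal R i (inl j)).
    by rewrite -rowC ?row_sub// inE /=.
  rewrite (rowWl _ il) -[X in (X <= _)%MS]/(tangent_normal R i (inr (l, true) : tangent_index n M)).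
  by rewrite -rowC ?row_sub// inE.
have -> : \rank C = \rank W by apply/eqP; rewrite eqn_leq !mxrankS.
by rewrite mxrankMfree ?row_free_unit// rank_copid_mx// ltnW.
Qed.

End TangentEdge.

(** * Lower bound for the bounded Lipschitz distance *)

Section TestFunction.
Context (R : realType) (n : nat) (i : 'I_n.+2) (N : nat).
Hypothesis N_gt0 : (0 < N)%N.
Implicit Types (u v : 'rV[R]_n.+2).

Definition gap_fun u : R := slope_gap i N u / 3.

Let N0 : (0 : R) < N%:R. Proof. by rewrite ltr0n. Qed.

Lemma slope_bounds (k : 'I_N.+1) : 0 <= slope R N k <= 2.
Proof.
rewrite /slope -mulrA; apply/andP; split; first by rewrite mulr_ge0// divr_ge0// ltW.
by rewrite ler_piMr// ler_pdivrMr// mul1r ler_nat -ltnS.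
Qed.

(** The constant 3 is 1, the coefficient of u_0, plus 2, the largest slope; whence the division by 3
    in [gap_fun]. *)
Let slope_gap_lip u v : slope_gap i N u - 3 * enorm (u - v) <= slope_gap i N v.
Proof.
have c l : `|u 0 l - v 0 l| <= enorm (u - v).
  by have := le_coord_enorm (u - v) l; rewrite !mxE.
have e0 := enorm_ge0 (u - v).
rewrite {2}/slope_gap; apply: le_bigmin => [|k _].
  have : slope_gap i N u <= `|u 0 i| by rewrite /slope_gap; exact: bigmin_le_id.
  have := ler_normD (u 0 i - v 0 i) (v 0 i); rewrite subrK.
  have := c i; lra.
have := slope_gap_le i u k; have /andP[s0 s2] := slope_bounds k.
have := ler_normD ((u 0 0 - v 0 0) + slope R N k * (u 0 i - v 0 i)) (v 0 0 + slope R N k * v 0 i).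
have := ler_normD (u 0 0 - v 0 0) (slope R N k * (u 0 i - v 0 i)).
have -> : u 0 0 - v 0 0 + slope R N k * (u 0 i - v 0 i) + (v 0 0 + slope R N k * v 0 i) =
  u 0 0 + slope R N k * u 0 i by ring.
rewrite normrM (ger0_norm s0).
have : slope R N k * `|u 0 i - v 0 i| <= 2 * enorm (u - v) by rewrite ler_pM.
have := c 0; lra.
Qed.

Lemma gap_fun_lip u v : `|gap_fun u - gap_fun v| <= enorm (u - v).
Proof.
have := slope_gap_lip u v; have := slope_gap_lip v u; rewrite (enorm_distC v u) /gap_fun.
by move=> h1 h2; rewrite ler_norml; apply/andP; split; lra.
Qed.

Lemma gap_fun_ge0 u : 0 <= gap_fun u.
Proof. by rewrite divr_ge0// slope_gap_ge0. Qed.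

Lemma gap_fun_bounded u : enorm u = 1 -> `|gap_fun u| <= 1.
Proof.
move=> u1; rewrite ger0_norm ?gap_fun_ge0// /gap_fun.
have : slope_gap i N u <= `|u 0 i| by rewrite /slope_gap; exact: bigmin_le_id.
by have := le_coord_enorm u i; rewrite u1; lra.
Qed.

End TestFunction.

Section OddEdges.
Context (R : realType) (n : nat) (i : 'I_n.+2) (N : nat).
Hypotheses (i_gt0 : (0 < i)%N) (N_gt0 : (0 < N)%N).

Local Notation M := (2 * N)%N.
Local Notation L := (@tangent_body R n i M).
Local Notation delta := (edge_thickness R n).

Let odd_lt (k : 'I_N) : (k.*2.+1 < M.+1)%N.
Proof. by move: (ltn_ord k); clear; lia. Qed.

Definition odd_index (k : 'I_N) : 'I_M.+1 := Ordinal (odd_lt k).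

Let odd_gt0 k : (0 < odd_index k)%N. Proof. by []. Qed.
Let odd_ltM k : (odd_index k < M)%N.
Proof. by rewrite /=; have := ltn_ord k; lia. Qed.

Let N0 : (0 : R) < N%:R. Proof. by rewrite ltr0n. Qed.

(** Old slopes are even multiples of 1 / N and this one is an odd multiple, so they differ by at
    least 1 / N; the difference is multiplied by |u_i|, which is at least [delta]. *)
Lemma odd_slope_gap (k : 'I_N) y : edge_box (odd_index k) y ->
  delta / (3 * N%:R) <= gap_fun i N (unit_normal L (edge_lift i (odd_index k) y)).
Proof.
move=> yB; have [ui u0] := edge_lift_normal i_gt0 (odd_gt0 k) (odd_ltM k) yB.
set u := unit_normal _ _ in ui u0 *.
have sE : slope R M (odd_index k) = k.*2.+1%:R / N%:R.
  by rewrite /slope /= natrM; field; rewrite gt_eqF.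
have N1 : N%:R^-1 <= 1 :> R by rewrite invf_le1// ler1n.
have d0 : 0 < delta := edge_thickness_gt0 R n.
have Ni0 : 0 <= N%:R^-1 :> R by rewrite invr_ge0 ltW.
suff : delta * N%:R^-1 <= slope_gap i N u.
  have -> : delta / (3 * N%:R) = delta * N%:R^-1 / 3 by field; rewrite gt_eqF.
  by rewrite /gap_fun => ?; rewrite ler_pM2r.
rewrite /slope_gap; apply: le_bigmin => [|k' _].
  by apply: le_trans ui; rewrite ler_piMr// ltW.
rewrite u0 sE /slope -mulNr -mulrDl normrM mulrC.
apply: ler_pM => //; first exact: ltW.
have step (a b : nat) : (a < b)%N -> N%:R^-1 <= b%:R / N%:R - a%:R / N%:R :> R.
  move=> ab; rewrite -mulrBl -[leLHS]mul1r ler_pM2r ?invr_gt0// lerBrDr.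
  by rewrite addrC natr1 ler_nat.
rewrite -natrM ler_normr.
have [/step|/step] : (2 * k' < k.*2.+1)%N \/ (k.*2.+1 < 2 * k')%N by lia.
  by move=> s; apply/orP; right; lra.
by move=> s; apply/orP; left; lra.
Qed.

Definition steep_set : set (borel_Sigma R n.+2) :=
  [set a | delta / (3 * N%:R) <= normal_fun (gap_fun i N) a].

Lemma measurable_steep_set : measurable steep_set.
Proof.
have mf := normal_fun_measurable (@gap_fun_lip R n i N N_gt0).
rewrite (_ : steep_set = normal_fun (gap_fun i N) @^-1` `[delta / (3 * N%:R), +oo[%classic).
  by rewrite -[X in measurable X]setTI; apply: mf => //; exact: measurable_itv.
by apply/seteqP; split=> a; rewrite /steep_set/= in_itv/= andbT.
Qed.

Lemma edge_box_shell (k : 'I_N) :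
  (hausdorff_measure n.+2 (@edge_box R n M (odd_index k)) <=
   hausdorff_measure n.+2 (shell_part (@tangent_normal R n i M) (@tangent_offset R n i M) 1
     (edge_active i (odd_index k)) steep_set))%E.
Proof.
apply: le_trans (@hausdorff_measure_expanding _ _ _ (edge_lift i (odd_index k)) _ _) _.
  by move=> x y _ _; exact: edge_lift_expanding.
apply: le_outer_measure => _ [y yB <-].
have Ky := edge_lift_out i_gt0 (odd_gt0 k) (odd_ltM k) yB.
have /andP[_ d1] := edge_lift_dist i_gt0 (odd_gt0 k) (odd_ltM k) yB.
split; last by rewrite /= (edge_lift_proj i_gt0 (odd_gt0 k) (odd_ltM k) yB) (edge_foot_active i_gt0 (odd_gt0 k) (odd_ltM k) yB).
split; first by split.
by rewrite /steep_set/= /normal_fun (val_normal_pt (tangent_body_convex R i M))//; exact: odd_slope_gap.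
Qed.

End OddEdges.

Lemma enorm_delta_mx (R : realType) n (l : 'I_n) : enorm (delta_mx 0 l : 'rV[R]_n) = 1.
Proof.
rewrite /enorm (bigD1 l)//= big1 ?addr0 => [|j jl]; last first.
  by rewrite mxE (negbTE jl) andbF expr0n.
by rewrite mxE !eqxx expr1n sqrtr1.
Qed.

Section HausdorffDistance.
Context (R : realType) (n : nat) (K L : set 'rV[R]_n) (r : R).
Hypotheses (convK : convex_body K) (convL : convex_body L) (r_gt0 : 0 < r).
Hypotheses (KL : forall x, K x -> exists2 z, L z & enorm (x - z) <= r).
Hypotheses (LK : forall x, L x -> exists2 z, K z & enorm (x - z) <= r).

Let subset_parallel (A B : set 'rV[R]_n) : convex_body B ->
  (forall x, A x -> exists2 z, B z & enorm (x - z) <= r) -> A `<=` parallel_body B r.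
Proof.
move=> convB AB x /AB[z Bz xz]; rewrite parallel_bodyE//=.
by apply: le_trans xz; exact: (metric_proj_spec convB x).2.
Qed.

Lemma hausdorff_dist_bounds : 0 <= hausdorff_dist K L <= r.
Proof.
have rP : [set rho | [/\ 0 <= rho, K `<=` parallel_body L rho
                   & L `<=` parallel_body K rho]] r.
  by split; [exact: ltW|exact: subset_parallel|exact: subset_parallel].
apply/andP; split; first by apply: lb_le_inf; [exists r|move=> s []].
by apply: ge_inf => //; exists 0 => s [].
Qed.

End HausdorffDistance.

Section Refinement.
Context (R : realType) (n : nat) (i : 'I_n.+2) (N : nat).
Hypotheses (i_gt0 : (0 < i)%N) (N_gt0 : (0 < N)%N).

Local Notation M := (2 * N)%N.
Local Notation K := (@tangent_body R n i N).
Local Notation L := (@tangent_body R n i M).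
Local Notation delta := (edge_thickness R n).
Local Notation H := (@hausdorff_measure R n.+2 n.+2).

Let N0 : (0 : R) < N%:R. Proof. by rewrite ltr0n. Qed.
Let i_neq0 : i != 0. Proof. by rewrite -lt0n. Qed.

Let slopeE N' k : slope R N' k = 2 * (k%:R / N'%:R).
Proof. by rewrite /slope mulrA. Qed.

Let double_ratio (k : nat) : (2 * k)%:R / (2 * N)%:R = k%:R / N%:R :> R.
Proof. by rewrite !natrM; field; rewrite gt_eqF. Qed.

Lemma tangent_body_refine : L `<=` K.
Proof.
move=> x /tangent_bodyP[xj xk]; apply/tangent_bodyP; split => // k.
have lt_k : (2 * k < M.+1)%N by have := ltn_ord k; lia.
have := xk (Ordinal lt_k); rewrite /= !slopeE.
by rewrite double_ratio.
Qed.

(** Raising x_i by [h] suffices: the tangent at an odd point is the mean of its two neighbours plus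
    (1 / (2 N))^2 = h. *)
Lemma tangent_body_approx x : K x ->
  exists2 z, L z & enorm (x - z) <= (4 * N%:R ^+ 2)^-1.
Proof.
move=> /tangent_bodyP[xj xk]; set h := (4 * _)^-1.
have h0 : 0 < h by rewrite invr_gt0 mulr_gt0// exprn_gt0.
have ub1 : upper_bound_coord R i i = 1 by rewrite /upper_bound_coord leqnn.
have ub0 : upper_bound_coord R i 0 = 1 by [].
have /andP[xi0 xi1] := xj i; rewrite ub1 in xi1.
have /andP[x00 x01] := xj 0; rewrite ub0 in x01.
(* The shift stops at x_i = 1; there every tangent constraint holds, because tangents lie below
   x_0^2 <= 1. *)
pose s := Num.min h (1 - x 0 i).
have [s0 sh s1] : [/\ 0 <= s, s <= h & x 0 i + s <= 1].
  by rewrite /s; case: (lerP h (1 - x 0 i)) => ?; split; lra.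
exists (x + s *: delta_mx 0 i); last first.
  by rewrite opprD addrA subrr sub0r enormN enormZ enorm_delta_mx mulr1 ger0_norm.
have z0 : (x + s *: delta_mx 0 i) 0 0 = x 0 0.
  by rewrite !mxE [0 == i]eq_sym (negbTE i_neq0) andbF mulr0 addr0.
have zi : (x + s *: delta_mx 0 i) 0 i = x 0 i + s by rewrite !mxE !eqxx mulr1.
apply/tangent_bodyP; split=> [l|k].
  have [->|li] := eqVneq l i; first by rewrite zi ub1 s1 andbT addr_ge0.
  by rewrite !mxE (negbTE li) andbF mulr0 addr0.
rewrite z0 zi slopeE; set c := k%:R / _.
suff tx : 2 * c * x 0 0 - c ^+ 2 <= x 0 i + h.
  have : 2 * c * x 0 0 - c ^+ 2 <= 1.
    by have := sqr_ge0 (x 0 0 - c); nra.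
  by rewrite /s; case: (lerP h (1 - x 0 i)) => ?; lra.
have [k' kE] : exists k' : nat, k = (2 * k')%N :> nat \/ k = (2 * k').+1%N :> nat.
  by exists (k./2); lia.
case: kE => kE; have lt_k' : (k' < N.+1)%N by have := ltn_ord k; lia.
  have := xk (Ordinal lt_k'); rewrite slopeE /= -(double_ratio k') -kE -/c; lra.
have lt_k'' : (k'.+1 < N.+1)%N by have := ltn_ord k; lia.
have := xk (Ordinal lt_k'); have := xk (Ordinal lt_k''); rewrite !slopeE /=.
have -> : c = k'%:R / N%:R + (2 * N%:R)^-1.
  by rewrite /c kE -natr1 !natrM; field; rewrite gt_eqF.
have -> : k'.+1%:R / N%:R = k'%:R / N%:R + 2 * (2 * N%:R)^-1 :> R.
  by rewrite -natr1; field; rewrite gt_eqF.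
have -> : h = (2 * N%:R)^-1 ^+ 2 by rewrite /h; field; rewrite gt_eqF.
by move: (k'%:R / _) ((2 * _)^-1) => a b; lra.
Qed.

Lemma hausdorff_dist_tangent_body : 0 <= hausdorff_dist K L <= (4 * N%:R ^+ 2)^-1.
Proof.
apply: hausdorff_dist_bounds; try exact: tangent_body_convex.
- by rewrite invr_gt0 mulr_gt0// exprn_gt0.
- exact: tangent_body_approx.
- move=> x Lx; exists x; first exact: tangent_body_refine.
  by rewrite subrr enorm0 invr_ge0 mulr_ge0// exprn_ge0.
Qed.

(* The N boxes over the odd edges have width 1 / (4 N): the bound is independent of N. *)
Definition steep_volume : R := (4^-1 * \prod_(l < n.+2 | l != 0) delta) *
  fine (H (dyadic_cube 0 [ffun=> 0%R])).

(** Different odd edges have different active sets, so their cells are separate terms of the sum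
    over active sets of rank n.+2 - i; the remaining terms are nonnegative. *)
Lemma hausdorff_steep_faces : (steep_volume%:E <=
  H (face_shell (@tangent_normal R n i M) (@tangent_offset R n i M) i `&`
     normal_pt L @^-1` @steep_set R n i N))%E.
Proof.
have convL := tangent_body_convex R i M.
rewrite (hausdorff_face_shell convL); last exact: measurable_steep_set.
have inj : injective (fun k : 'I_N => @edge_active n i M (odd_index k)).
  move=> k k' /setP /(_ (inl (odd_index k))); rewrite !inE eqxx => /esym/eqP.
  by move=> /(congr1 val) /= => e; apply: val_inj => /=; lia.
set S := [set edge_active i (odd_index k) | k in 'I_N]%SET.
rewrite (bigID (mem S))/=.
apply: (@le_trans _ _ (\sum_(A in S) H (shell_part (@tangent_normal R n i M)
    (@tangent_offset R n i M) 1 A (@steep_set R n i N)))%E); last first.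
  rewrite [X in (_ <= X + _)%E](eq_bigl (mem S)) => [|A]; last first.
    rewrite andb_idl// => /imsetP[k _ ->]; apply/eqP; exact: edge_codim.
  by rewrite leeDl// sume_ge0// => A _; exact: hausdorff_measure_ge0.
rewrite big_imset/=; last by move=> k k' _ _; exact: inj.
apply: (@le_trans _ _ (\sum_(k < N) H (@edge_box R n M (odd_index k)))%E); last first.
  by apply: lee_sum => k _; exact: edge_box_shell.
rewrite (eq_bigr (fun=> (steep_volume / N%:R)%:E)) => [|k _]; last first.
  rewrite hausdorff_edge_box; last by rewrite /=; have := ltn_ord k; lia.
  rewrite -[X in (_ * X)%E]fineK ?unit_cube_fin_num// -EFinM /steep_volume natrM; congr _%:E.
  by field; rewrite gt_eqF.
rewrite sumEFin sumr_const card_ord -[X in (_ <= X%:E)%E]mulr_natr divfK// gt_eqF//.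
Qed.

Lemma steep_volume_gt0 : 0 < steep_volume.
Proof.
rewrite /steep_volume mulr_gt0// ?mulr_gt0// ?invr_gt0//.
  by apply: prodr_gt0 => l _; exact: edge_thickness_gt0.
rewrite fine_gt0// hausdorff_unit_cube_gt0/= -ge0_fin_numE ?unit_cube_fin_num//.
exact: hausdorff_measure_ge0.
Qed.

Definition steep_mass : R := (fine (kappa R (n.+2 - i)))^-1 * steep_volume.

Lemma steep_mass_gt0 : 0 < steep_mass.
Proof.
rewrite mulr_gt0// ?steep_volume_gt0// invr_gt0 fine_gt0// kappa_gt0/=.
by rewrite -ge0_fin_numE ?kappa_fin_num// ltW// kappa_gt0.
Qed.

Lemma dbL_tangent_body : exists LamK LamL,
  [/\ support_measures K LamK, support_measures L LamL &
   ((delta / (3 * N%:R) * steep_mass)%:E <= dbL (LamK i) (LamL i))%E].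
Proof.
have [LamK [sK LamKE]] := polyhedron_support_measures (tangent_body_convex R i N).
have [LamL [sL LamLE]] := polyhedron_support_measures (tangent_body_convex R i M).
exists LamK, LamL; split => //.
have lip := @gap_fun_lip R n i N N_gt0.
have bd := @gap_fun_bounded R n i N.
have mf := normal_fun_measurable lip.
have f0 (a : Sigma R n.+2) : 0 <= normal_fun (gap_fun i N) a by exact: gap_fun_ge0.
have f1 (a : Sigma R n.+2) : normal_fun (gap_fun i N) a <= 1.
  by apply: le_trans (ler_norm _) _; exact: (normal_fun_bounded bd a).
apply: le_trans (dbL_normal_fun lip bd _ _).
(* Only the integral over the finer body remains; Markov's inequality on [steep_set] bounds it
   below. *)
rewrite (Rintegral_eq0 mf f0) ?sub0r ?normrN; last first.
  rewrite LamKE (_ : _ `&` _ = set0) ?hausdorff_measure0 ?mule0//.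
  apply/seteqP; split=> // x [xF /=].
  have [[Kx _] _] := xF.
  rewrite /normal_fun (val_normal_pt (tangent_body_convex R i N) Kx) /= /gap_fun.
  by rewrite (slope_gap_face i_gt0 xF) mul0r eqxx.
rewrite lee_fin; apply: le_trans (ler_norm _).
have e0 : 0 <= delta / (3 * N%:R).
  by rewrite divr_ge0 ?mulr_ge0// ltW// edge_thickness_gt0.
apply: le_trans (le_Rintegral_level (LamL i) mf f0 e0 f1).
apply: ler_wpM2l => //.
have LamLfin : LamL i (@steep_set R n i N) \is a fin_num.
  by apply: fin_num_measure; exact: measurable_steep_set.
rewrite -lee_fin fineK// LamLE EFinM; apply: lee_wpmul2l; last exact: hausdorff_steep_faces.
by rewrite lee_fin invr_ge0 fine_ge0// ltW// kappa_gt0.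
Qed.

End Refinement.

Lemma power_rate_fails (R : realType) (c C alpha : R) : 0 < c -> 0 < C -> 1 / 2 < alpha ->
  exists2 N : nat, (0 < N)%N & C * (4 * N%:R ^+ 2)^-1 `^ alpha < c / N%:R.
Proof.
(* N^(-2 alpha) is N^(-beta) / N, so it suffices that C N^(-beta) < c, that is 1 / N < e with e^beta
   = c / C. *)
move=> c0 C0 a2; pose beta := 2 * alpha - 1; have b0 : 0 < beta by rewrite /beta; lra.
pose e := (c / C) `^ beta^-1; have e0 : 0 < e by rewrite powR_gt0// divr_gt0.
pose N := (Num.truncn e^-1).+1; exists N => //.
have N0 : 0 < N%:R :> R by rewrite ltr0n.
have Ne : N%:R^-1 < e by rewrite -[e]invrK ltf_pV2 ?posrE ?invr_gt0// truncnS_gt.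
apply: (@le_lt_trans _ _ (C * (N%:R^-1 `^ beta / N%:R))); last first.
  rewrite mulrA ltr_pM2r ?invr_gt0// mulrC -ltr_pdivlMr//.
  have -> : c / C = e `^ beta by rewrite /e -powRrM mulVf ?gt_eqF// powRr1// divr_ge0// ltW.
  by apply: gt0_ltr_powR => //; rewrite nnegrE ltW// invr_gt0.
rewrite ler_pM2l//.
have -> : N%:R^-1 `^ beta / N%:R = (N%:R^-1 ^+ 2) `^ alpha.
  rewrite -powR_mulrn ?invr_ge0 ?ltW// -powRrM.
  have -> : 2 * alpha = beta + 1 by rewrite /beta; ring.
  have n0 : N%:R^-1 != 0 :> R by rewrite invr_eq0 gt_eqF.
  by rewrite [in RHS]powRD ?n0 ?implybT// powRr1 ?invr_ge0 ?ltW.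
rewrite ge0_ler_powR ?nnegrE ?exprn_ge0 ?invr_ge0 ?mulr_ge0 ?exprn_ge0//; try lra.
by rewrite invfM exprVn ler_piMl ?invr_ge0 ?exprn_ge0//; lra.
Qed.

(* The dimension is n.+2. *)
Theorem mainTheorem3 (R : realType) (n : nat) (i : 'I_n.+2) (hi : (1 <= i)%N)
    (alpha : R) (halpha : 1 / 2 < alpha) :
  ~ exists C : {posnum R} -> {posnum R},
      forall (r : {posnum R}) (K L : set 'rV[R]_n.+2),
        convex_body K -> convex_body L ->
        (exists z : 'rV[R]_n.+2,
           parallel_body K 2 `<=` eball z r%:num /\
           parallel_body L 2 `<=` eball z r%:num) ->
        forall LamK LamL :
            'I_n.+2 -> {finite_measure set (borel_Sigma R n.+2) -> \bar R},
          support_measures K LamK -> support_measures L LamL ->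
          (dbL (LamK i) (LamL i) <=
           ((C r)%:num * hausdorff_dist K L `^ alpha)%:E)%E.
Proof.
move=> [C hC]; have r0 : 0 < n.+2%:R + 2 :> R by rewrite addr_gt0.
(* One radius for all N: n.+2 bounds the norm on every body and 2 is the parallel distance. So [C r]
   is a single constant, and N can be chosen after it. *)
pose r := PosNum r0; pose c := edge_thickness R n / 3 * steep_mass R i.
have c0 : 0 < c by rewrite mulr_gt0 ?divr_gt0 ?edge_thickness_gt0 ?steep_mass_gt0.
have [N N0] := power_rate_fails c0 (gt0 (C r)) halpha.
have ball N' : parallel_body (tangent_body i N') 2 `<=` eball (0 : 'rV[R]_n.+2) r%:num.
  move=> _ [x xK [b b1 <-]]; rewrite /eball/= !subr0 in b1 *.
  apply: le_trans (enormD _ _) _; rewrite -[leRHS]/(n.+2%:R + 2).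
  apply: lerD; first exact: tangent_body_bounded xK.
  by rewrite enormZ ger0_norm// ler_piMr.
have [LamK [LamL [sK sL lower]]] := dbL_tangent_body R hi N0.
suff h : c / N%:R <= (C r)%:num * (4 * N%:R ^+ 2)^-1 `^ alpha by rewrite ltNge h.
have inball : exists z : 'rV[R]_n.+2, parallel_body (tangent_body i N) 2 `<=` eball z r%:num /\
    parallel_body (tangent_body i (2 * N)) 2 `<=` eball z r%:num by exists 0; split; exact: ball.
have := le_trans lower (hC r _ _ (tangent_body_convex R i N) (tangent_body_convex R i (2 * N))
  inball _ _ sK sL).
rewrite lee_fin => h.
have -> : c / N%:R = edge_thickness R n / (3 * N%:R) * steep_mass R i.
  by rewrite /c; field; rewrite pnatr_eq0 -lt0n.
apply: le_trans h _; rewrite ler_pM2l//.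
have /andP[d0 d1] := hausdorff_dist_tangent_body R hi N0.
rewrite ge0_ler_powR ?nnegrE ?(le_trans d0 d1)//; lra.
Qed.
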